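(* Let $S$ be a nonempty closed convex subset of a Banach space $E$ and let $T : S\to \mathcal{P}(S)$ be a multi-valued mapping with a weakly sequentially closed graph such that: (i) there exists a bounded set $\Omega$ belonging to the family $\{S^T_n : n\in\mathbb{N}\}$; (ii) $T$ is hemi-weakly compact on $\Omega$ and has closed, convex values on $\Omega$; (iii) $T$ is countably $\beta$-nonexpansive on $\Omega$. Then $T$ has at least one fixed point in $\Omega$, i.e. there is $x\in\Omega$ with $x\in T(x)$.
   Context: $\mathcal{P}(S)$ is the family of all nonempty subsets of $S$. For $M\subset S$, $T(M)=\bigcup_{x\in M}T(x)$. $\rightharpoonup$ denotes weak convergence. $\mathbb N$ includes $0$. The sequence $(S^T_n)$ is defined by $S^T_0=S$ and $S^T_{n+1}=\overline{co}(T(S^T_n))$, $n=0,1,\dots$, where $\overline{co}$ is the closed convex hull. $T$ has a weakly sequentially closed graph if whenever $x_n\in S$, $x_n\rightharpoonup x\in S$, $y_n\in T(x_n)$ and $y_n\rightharpoonup y$ in $E$, then $y\in T(x)$. $T$ is hemi-weakly compact on $\Omega$ if, for every sequence $(x_n)$ in $\Omega$ and every choice $y_n\in T(x_n)$ such that $(x_n-y_n)$ converges weakly, $(x_n)$ has a weakly convergent subsequence. $\beta$ is the De Blasi measure of weak noncompactness: for bounded $W\subset E$, $\beta(W)=\inf\{\varepsilon>0:\ \exists K\subset E \text{ weakly compact},\ W\subset K+\mathcal{B}_E(\varepsilon)\}$, where $\mathcal{B}_E(\varepsilon)$ is the closed ball of radius $\varepsilon$ centred at the origin. $T$ is countably $\beta$-nonexpansive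 on $\Omega$ if $T$ is bounded on $\Omega$ (maps bounded subsets of $\Omega$ to bounded sets) and $\beta(T(W))\le\beta(W)$ for every countable bounded subset $W$ of $\Omega$. *)

(* Defs.v *)
From HB Require Import structures.
From mathcomp Require Import all_boot all_order all_algebra.
From mathcomp Require Import all_classical all_reals all_analysis.

Set Implicit Arguments.
Unset Strict Implicit.
Unset Printing Implicit Defensive.

Import Order.TTheory GRing.Theory Num.Theory.
Import numFieldNormedType.Exports.

Local Open Scope classical_set_scope.
Local Open Scope ring_scope.

Section WeakTopology.
Context {R : realType} (E : normedModType R).

Definition cont_dual : Type :=
  {f : {linear E -> R^o} | continuous (f : E -> R^o)}.

(* The weak topology sigma(E, E'): the coarsest topology on the carrier of E
   that makes every continuous linear functional continuous.  The carrier is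
   convertible to E, so a [set E] or a sequence in E can be read as living in
   [weak_topology]. *)
Definition weak_topology : topologicalType :=
  sup_topology (fun f : cont_dual =>
    Topological.on (initial_topology (sval f : E -> R^o))).

Definition weak_cvg_to (u : nat -> E) (x : E) : Prop :=
  (u : nat -> weak_topology) @ \oo --> (x : weak_topology).

Definition weakly_compact (K : set E) : Prop :=
  compact (K : set weak_topology).

Lemma weak_cvg_toP (u : nat -> E) (x : E) :
  weak_cvg_to u x <->
  forall f : {linear E -> R^o}, continuous (f : E -> R^o) ->
    f (u n) @[n --> \oo] --> f x.
Proof.
rewrite /weak_cvg_to; split=> [/cvg_sup ux f cf A Afx|ux].
  have /= := ux (exist _ f cf) (f @^-1` A); apply.
  exact: (@initial_continuous E R^o f x A Afx).
apply/cvg_sup => -[f cf] A [_ [[C oC <-] Cx CA]].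
have := ux f cf C (open_nbhs_nbhs (conj oC Cx)).
by apply: (@filterS _ \oo _ (u @^-1` (f @^-1` C))) => n; exact: CA.
Qed.

End WeakTopology.

Section Multimaps.
Context {R : realType} {E : normedModType R}.
Implicit Types (S M W K Omega : set E) (T : E -> set E).

(* A multi-valued map S -> P(S) is represented by a total T : E -> set E of
   which only the values on S are constrained (and used). *)
Definition multimap_on S T : Prop :=
  forall x, S x -> T x !=set0 /\ T x `<=` S.

Definition mimage T M : set E := \bigcup_(x in M) T x.

Definition closed_convex_hull M : set E :=
  smallest [set A : set E | closed A /\ convex_set A] M.

Fixpoint iter_hull S T (n : nat) : set E :=
  if n is m.+1 then closed_convex_hull (mimage T (iter_hull S T m)) else S.

Definition weakly_seq_closed_graph S T : Prop :=
  forall (u v : nat -> E) (x y : E),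
    (forall n, S (u n)) -> S x -> weak_cvg_to u x ->
    (forall n, T (u n) (v n)) -> weak_cvg_to v y ->
    T x y.

Definition hemi_weakly_compact Omega T : Prop :=
  forall u v : nat -> E,
    (forall n, Omega (u n)) -> (forall n, T (u n) (v n)) ->
    (exists l, weak_cvg_to (fun n => u n - v n) l) ->
    exists2 phi : nat -> nat, increasing_seq phi &
      exists l, weak_cvg_to (u \o phi) l.

(* De Blasi measure of weak noncompactness.  It is meaningful for bounded W
   only; for unbounded W the set below may be empty, and the infimum of the
   empty set is 0 by convention. *)
Definition deBlasi W : R :=
  inf [set e : R | 0 < e /\ exists2 K, weakly_compact K &
    W `<=` [set x + y | x in K & y in closed_ball (0 : E) e]].

Definition bounded_on Omega T : Prop :=
  forall W, W `<=` Omega -> bounded_set W -> bounded_set (mimage T W).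

Definition countably_beta_nonexpansive Omega T : Prop :=
  bounded_on Omega T /\
  forall W, W `<=` Omega -> countable W -> bounded_set W ->
    deBlasi (mimage T W) <= deBlasi W.

End Multimaps.

(* Main.v *)
(* Damping.  Fix x0 in Omega and 0 < c < 1, choose b w in T w, and let W be the
   countable set generated from x0 by the map h w = c b(w) + (1 - c) x0 and by
   rational convex combinations.  Krein's theorem gives beta(W) <= c beta(T(W))
   <= c beta(W), so beta(W) = 0 and the closure C of W is weakly compact, by
   Grothendieck's criterion.
   Fixed points.  Countably many functionals separate the points of C.  Scarf's
   combinatorial lemma, applied to a grid on the simplex spanned by the points
   h(a_i) for a finite net (a_i) of W, yields x_k in C such that every unit
   functional f satisfies f(x_k) <= f(h(a)) + 1/(k+1) for some a in W that is
   close to x_k for the first k of these functionals.  At a weak limit x of (x_k)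
   the closed graph, together with the separation of x from the closed convex set
   c T(x) + (1 - c) x0, shows that x lies in this set.
   Letting c tend to 1, one gets x_n in Omega and y_n in T(x_n) with
   x_n - y_n -> 0, and hemi-weak compactness with the closed graph concludes. *)

(* Three obstacles shape the argument. Condition (iii) speaks of countable sets only, so the compact
   set C has to come from one selection [b] and rational coefficients. This [b] is arbitrary and in
   general discontinuous, and C is invariant only under [h], and only on W, not under the damped
   multimap; fixed point theorems for continuous or upper semicontinuous maps on C are therefore out
   of reach. Finally, the graph is closed for sequences only, so every limit is extracted with
   Eberlein's theorem and identified through countably many functionals. The functional that
   separates the limit x from c T(x) + (1 - c) x0 is known only once x is. Hence x_k must serve all
   unit functionals at once, and only the point a may depend on f. A combinatorial lemma on a grid
   gives exactly this order of choices, because f(x_k) is a weighted mean of the values f(h(a_i)).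
   Krein's theorem is obtained without measures: Pták's lemma replaces dominated convergence on the
   compact set. *)
Require Import Defs.
From HB Require Import structures.
From mathcomp Require Import all_boot all_order all_algebra.
From mathcomp Require Import all_classical all_reals all_analysis.
From mathcomp Require Import zify ring lra.
Import Order.TTheory GRing.Theory Num.Theory.
Import numFieldNormedType.Exports.
Local Open Scope classical_set_scope.
Local Open Scope ring_scope.

(** * Hahn-Banach *)

Definition sublinear {R : realType} {V : lmodType R} (q : V -> R) : Prop :=
  (forall x y, q (x + y) <= q x + q y) /\
  (forall (t : R) x, 0 <= t -> q (t *: x) <= t * q x).

Section HahnBanach.
Context {R : realType} {V : lmodType R}.
Implicit Types (p q : V -> R) (x y : V) (s t c : R).

Lemma sublinear0 q : sublinear q -> q 0 = 0.
Proof.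
move=> [qD qZ]; have := qD 0 0; have := qZ 0 0 (lexx _).
by rewrite scale0r addr0; lra.
Qed.

Lemma sublinearN q x : sublinear q -> - q (- x) <= q x.
Proof.
by move=> sq; have := sq.1 x (- x); rewrite subrr (sublinear0 _ sq); lra.
Qed.

Lemma sublinearZ_ge q t x : sublinear q -> 0 <= t -> t * q x <= q (t *: x).
Proof.
move=> sq; rewrite le_eqVlt => /predU1P[<-|t0].
  by rewrite scale0r mul0r sublinear0.
have := sq.2 t^-1 (t *: x); rewrite scalerA mulVf ?gt_eqF// scale1r.
by rewrite invr_ge0 ltW// => /(_ isT); rewrite ler_pdivlMl.
Qed.

(** For sublinear [q], this is the largest sublinear function below [q] whose value at [- y] is at
    most [- q y]. *)
Definition sublinear_shift q y x : R :=
  inf [set q (x + t *: y) - t * q y | t in [set t : R | 0 <= t]].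

Lemma sublinear_shift_lb q y x t : sublinear q -> 0 <= t ->
  - q (- x) <= q (x + t *: y) - t * q y.
Proof.
move=> sq t0; have := sq.1 (x + t *: y) (- x).
rewrite addrAC subrr add0r; have := sublinearZ_ge q t y sq t0; lra.
Qed.

Lemma sublinear_shift_le q y x t : sublinear q -> 0 <= t ->
  sublinear_shift q y x <= q (x + t *: y) - t * q y.
Proof.
move=> sq t0; apply: ge_inf; last by exists t.
by exists (- q (- x)) => _ [s s0 <-]; exact: sublinear_shift_lb.
Qed.

Lemma sublinear_shift_ge q y x c :
  (forall t, 0 <= t -> c <= q (x + t *: y) - t * q y) ->
  c <= sublinear_shift q y x.
Proof.
move=> cq; apply: lb_le_inf; first by exists (q (x + 0 *: y) - 0 * q y), 0 => /=.
by move=> _ [t /= t0 <-]; exact: cq.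
Qed.

Lemma sublinear_shiftP q y : sublinear q -> sublinear (sublinear_shift q y).
Proof.
move=> sq; split=> [x z|t x t0].
  rewrite -lerBlDr; apply: sublinear_shift_ge => s s0.
  rewrite lerBlDr -lerBlDl; apply: sublinear_shift_ge => t t0.
  have := sublinear_shift_le q y (x + z) (s + t) sq (addr_ge0 s0 t0).
  have := sq.1 (x + s *: y) (z + t *: y).
  have -> : x + s *: y + (z + t *: y) = x + z + (s + t) *: y.
    by rewrite addrACA scalerDl.
  by lra.
move: t0; rewrite le_eqVlt => /predU1P[<-|t0].
  rewrite scale0r mul0r; have := sublinear_shift_le q y 0 0 sq (lexx _).
  by rewrite scale0r mul0r addr0 subr0 (sublinear0 _ sq).
rewrite -ler_pdivrMl//; apply: sublinear_shift_ge => s s0; rewrite ler_pdivrMl//.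
have := sublinear_shift_le q y (t *: x) (t * s) sq (mulr_ge0 (ltW t0) s0).
have := sq.2 t (x + s *: y) (ltW t0).
by rewrite scalerDr scalerA mulrBr -mulrA; lra.
Qed.

(* A minimal sublinear function q coincides with its shifts, which forces
   q x + q y <= q (x + y); minimal elements exist by Zorn's lemma. *)
Lemma hahn_banach p : sublinear p ->
  exists2 f : V -> R, (forall a x y, f (a *: x + y) = a * f x + f y) &
    forall x, f x <= p x.
Proof.
move=> sp; pose T := {q : V -> R | sublinear q /\ forall x, q x <= p x}.
pose r (s t : T) := `[< forall x, sval t x <= sval s x >].
have [||||[q [sq qp]] qmin] := @Zorn T r.
- by move=> t; apply/asboolP.
- move=> s t u /asboolP st /asboolP tu; apply/asboolP => x.
  exact: le_trans (tu x) (st x).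
- move=> [s ps] [t pt] /asboolP /= st /asboolP /= ts; apply: eq_exist.
  by apply/funext => x; apply/eqP; rewrite eq_le st ts.
- move=> A Atot; have [->|/set0P[s0 As0]] := eqVneq A set0.
    by exists (exist _ p (conj sp (fun x => lexx _))).
  (* The order [r] is reversed, so an upper bound of the chain is its pointwise infimum; it is
     finite because every member is at least [- p (- x)] at [x]. *)
  pose t x := inf [set sval s x | s in A].
  have ne x : [set sval s x | s in A] !=set0 by exists (sval s0 x), s0.
  have tle (s : T) x : A s -> t x <= sval s x.
    move=> As; apply: ge_inf; last by exists s.
    exists (- p (- x)) => _ [[u [su up]] Au <-] /=.
    by apply: le_trans (sublinearN u x su); rewrite lerN2.
  have st : sublinear t.
    split=> [x y|a x a0].
      rewrite -lerBlDr; apply: lb_le_inf => // _ [u Au <-].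
      rewrite lerBlDr -lerBlDl; apply: lb_le_inf => // _ [v Av <-].
      rewrite lerBlDl; have [/asboolP uv|/asboolP vu] := Atot _ _ Au Av.
        apply: le_trans (tle v _ Av) _; apply: le_trans ((svalP v).1.1 _ _) _.
        by rewrite lerD2r uv.
      apply: le_trans (tle u _ Au) _; apply: le_trans ((svalP u).1.1 _ _) _.
      by rewrite lerD2l vu.
    move: (a0); rewrite le_eqVlt => /predU1P[<-|apos].
      rewrite scale0r mul0r; apply: le_trans (tle _ _ As0) _.
      by rewrite (sublinear0 _ (svalP s0).1).
    rewrite -ler_pdivrMl//; apply: lb_le_inf => // _ [u Au <-].
    rewrite ler_pdivrMl//; apply: le_trans (tle u _ Au) _.
    exact: (svalP u).1.2.
  have tp x : t x <= p x := le_trans (tle s0 x As0) ((svalP s0).2 x).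
  exists (exist _ t (conj st tp)) => s As; apply/asboolP => x /=.
  exact: tle.
have qle y x : q x + q y <= q (x + y).
  have q'q z : sublinear_shift q y z <= q z.
    have := sublinear_shift_le q y z 0 sq (lexx _).
    by rewrite scale0r mul0r addr0 subr0.
  have q'p z : sublinear_shift q y z <= p z by exact: le_trans (qp z).
  have := qmin (exist _ (sublinear_shift q y)
    (conj (sublinear_shiftP q y sq) q'p)) (asboolT q'q).
  move=> /(congr1 sval) /= /(congr1 (fun g => g x)) <-.
  have := sublinear_shift_le q y x 1 sq ler01.
  by rewrite scale1r mul1r; lra.
have qD x y : q (x + y) = q x + q y.
  by apply/eqP; rewrite eq_le qle sq.1.
have qN x : q (- x) = - q x.
  have := qD x (- x); rewrite subrr sublinear0//; lra.
have qZ a x : q (a *: x) = a * q x.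
  have pos (b : R) : 0 <= b -> q (b *: x) = b * q x.
    by move=> b0; apply/eqP; rewrite eq_le sq.2//= sublinearZ_ge.
  have [/pos//|a0] := leP 0 a.
  rewrite -[a]opprK scaleNr qN pos ?oppr_ge0 1?ltW//; ring.
by exists q => // a x y; rewrite qD qZ.
Qed.

End HahnBanach.

(** * Functionals and the weak topology *)

Lemma inv_succ_lt {R : realType} (e : R) : 0 < e ->
  exists N, forall n, (N <= n)%N -> n.+1%:R^-1 < e.
Proof.
move=> e0; exists (Num.truncn e^-1) => n Nn.
rewrite -[e]invrK ltf_pV2 ?posrE ?invr_gt0 ?ltr0n//.
by apply: lt_le_trans (truncnS_gt _) _; rewrite ler_nat ltnS.
Qed.

Lemma cvg_inv_succ {R : realType} : (n.+1%:R^-1 : R) @[n --> \oo] --> (0 : R).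
Proof.
apply/cvgrPdist_lt => e /inv_succ_lt[N Ne]; exists N => // n /= /Ne.
by rewrite sub0r normrN ger0_norm ?invr_ge0 ?ler0n.
Qed.

(** Plain functions rather than bundled linear maps, so that combinations of functionals are lambda
    terms with an explicit norm bound. *)
Definition dual_ball {R : realType} {E : normedModType R} (r : R) (f : E -> R) :=
  (forall a x y, f (a *: x + y) = a * f x + f y) /\
  (forall x, `|f x| <= r * `|x|).

Section DualBall.
Context {R : realType} {E : normedModType R}.
Implicit Types (f g : E -> R) (x y : E) (r s c : R).

Lemma dual_ball0 r f : dual_ball r f -> f 0 = 0.
Proof. by move=> [_ /(_ 0)]; rewrite normr0 mulr0 normr_le0 => /eqP. Qed.

Lemma dual_ballD r f x y : dual_ball r f -> f (x + y) = f x + f y.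
Proof. by move=> [fl _]; rewrite -[x in LHS]scale1r fl mul1r. Qed.

Lemma dual_ballZ r f c x : dual_ball r f -> f (c *: x) = c * f x.
Proof.
move=> fr; rewrite -[c *: x]addr0 fr.1 (dual_ball0 r f fr) addr0 //.
Qed.

Lemma dual_ballN r f x : dual_ball r f -> f (- x) = - f x.
Proof. by move=> fr; rewrite -scaleN1r (dual_ballZ r f _ _ fr) mulN1r. Qed.

Lemma dual_ballB r f x y : dual_ball r f -> f (x - y) = f x - f y.
Proof. by move=> fr; rewrite (dual_ballD r f _ _ fr) (dual_ballN r f _ fr). Qed.

Lemma dual_ball_lin r s c f g : dual_ball r f -> dual_ball s g ->
  dual_ball (r + `|c| * s) (fun x => f x + c * g x).
Proof.
move=> [fl fr] [gl gs]; split=> [a x y|x]; first by rewrite fl gl; ring.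
rewrite (le_trans (ler_normD _ _))// mulrDl lerD// normrM -mulrA.
by rewrite ler_wpM2l.
Qed.

Lemma dual_ball_scale s c g : dual_ball s g ->
  dual_ball (`|c| * s) (fun x => c * g x).
Proof.
move=> [gl gs]; split=> [a x y|x]; first by rewrite gl; ring.
by rewrite normrM -mulrA ler_wpM2l.
Qed.

Lemma dual_ball_le r s f : r <= s -> dual_ball r f -> dual_ball s f.
Proof.
by move=> rs [fl fr]; split=> // x; apply: le_trans (fr x) _; rewrite ler_wpM2r.
Qed.

Lemma dual_ball_le_norm f x : dual_ball 1 f -> f x <= `|x|.
Proof. by move=> [_ /(_ x)]; rewrite mul1r; apply: le_trans; exact: ler_norm. Qed.

Lemma dual_ball_continuous r f : dual_ball r f -> continuous (f : E -> R^o).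
Proof.
move=> [fl fr].
pose F := GRing.isLinear.Build R E R^o _ (f : E -> R^o) fl.
pose G : {linear E -> R^o} := HB.pack (f : E -> R^o) F.
apply: (@linear_bounded_continuous _ _ _ G).1; apply/linear_boundedP.
exists r; split; first exact: num_real.
by move=> s rs x; apply: le_trans (fr x) _; rewrite ler_wpM2r// ltW.
Qed.

Lemma continuous_dual_ball (f : {linear E -> R^o}) :
  continuous (f : E -> R^o) -> exists2 r : R, 0 < r & dual_ball r f.
Proof.
move=> /linear_bounded_continuous/linear_boundedP/pinfty_ex_gt0[r r0 fr].
by exists r => //; split=> // a x y; rewrite linearP.
Qed.

(** Stated for arbitrary filters because weak compactness is handled through ultrafilters. *)
Lemma weak_cvgP (F : set_system E) {FF : Filter F} x :
  (F : set_system (weak_topology E)) --> (x : weak_topology E) <->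
  forall r f, dual_ball r f -> f @ F --> f x.
Proof.
split=> [/cvg_sup Fx r f fr|Fx].
  have cf := dual_ball_continuous r f fr.
  pose Fl := GRing.isLinear.Build R E R^o _ (f : E -> R^o) fr.1.
  pose G : {linear E -> R^o} := HB.pack (f : E -> R^o) Fl.
  move=> A Afx; have /= := Fx (exist _ G cf) (f @^-1` A); apply.
  exact: (@initial_continuous E R^o f x A Afx).
apply/cvg_sup => -[f cf] A [_ [[C oC <-] Cx CA]].
have [r _ fr] := continuous_dual_ball f cf.
have := Fx r f fr C (open_nbhs_nbhs (conj oC Cx)).
by apply: (@filterS _ F _ (f @^-1` C)) => n; exact: CA.
Qed.

Lemma cvg_dual_ball (F : set_system E) {FF : Filter F} x :
  (forall f, dual_ball 1 f -> f @ F --> f x) ->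
  forall r f, dual_ball r f -> f @ F --> f x.
Proof.
(* Adding 1 keeps the scaling factor positive whatever [r] is. *)
move=> Fx r f fr; pose s : R := `|r| + 1.
have s0 : 0 < s by rewrite ltr_pwDr.
have rs : r <= s by have := ler_norm r; rewrite /s; lra.
have := dual_ball_scale _ s^-1 _ (dual_ball_le _ _ _ rs fr).
rewrite ger0_norm ?invr_ge0 ?ltW// mulVf ?gt_eqF// => g1.
have sK c : c = s * (s^-1 * c) by rewrite mulVKf// gt_eqF.
have := cvgM (@cvg_cst _ s _ F _) (Fx _ g1).
rewrite -sK (_ : _ \* _ = f); first exact.
by apply/funext => y /=; rewrite -sK.
Qed.

Lemma weak_cvg_seqP (u : nat -> E) x :
  weak_cvg_to u x <->
  forall f, dual_ball 1 f -> f (u n) @[n --> \oo] --> f x.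
Proof.
split=> [/weak_cvgP ux f f1|ux]; first exact: (ux 1 f f1).
by apply/(@weak_cvgP (fmap u \oo) _ x); exact: cvg_dual_ball.
Qed.

End DualBall.

(** * Convex sets: separation and weak closedness *)

Section Convex.
Context {R : realType} {E : normedModType R}.
Implicit Types (A B : set E) (x y : E) (r s c d t : R).

Lemma convex_setP A : convex_set A <->
  forall x y t, 0 <= t <= 1 -> A x -> A y -> A (t *: x + (1 - t) *: y).
Proof.
split=> [cA x y t /andP[t0 t1] Ax Ay|cA x y t /set_mem Ax /set_mem Ay].
  have := cA x y (@Itv01 R t t0 t1) (mem_set Ax) (mem_set Ay).
  by rewrite inE.
rewrite inE; apply: cA => //; by apply/andP; split; [exact: ge0|exact: le1].
Qed.

(** Unnormalised weights allow an induction over finite sums whose partial weights may vanish; if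
    [s + t = 0], any point of [A] will do. *)
Lemma convex_cone A x y s t : convex_set A -> A x -> A y -> 0 <= s -> 0 <= t ->
  exists2 z, A z & s *: x + t *: y = (s + t) *: z.
Proof.
move=> /convex_setP cA Ax Ay s0 t0.
have [st0|st] := eqVneq (s + t) 0.
  have [-> ->] : s = 0 /\ t = 0 by split; lra.
  by exists x => //; rewrite addr0 !scale0r addr0.
have stp : 0 < s + t by rewrite lt_neqAle eq_sym st addr_ge0.
exists ((s / (s + t)) *: x + (1 - s / (s + t)) *: y).
  apply: cA => //; apply/andP; split; first by rewrite divr_ge0 ?addr_ge0.
  by rewrite ler_pdivrMr// mul1r; lra.
rewrite scalerDr !scalerA; congr (_ *: _ + _ *: _); by field.
Qed.

Lemma convex_sum A (I : finType) (a : I -> E) (w : I -> R) : convex_set A ->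
  (forall i, A (a i)) -> (forall i, 0 <= w i) -> \sum_i w i = 1 ->
  A (\sum_i w i *: a i).
Proof.
move=> cA Aa w0 w1.
have [i0 _] : exists i0 : I, true.
  apply: contrapT => nI; move: w1; rewrite big1 => [/esym/eqP|i _].
    by rewrite oner_eq0.
  by exfalso; apply: nI; exists i.
suff [z Az ->] : exists2 z, A z & \sum_i w i *: a i = (\sum_i w i) *: z.
  by rewrite w1 scale1r.
elim: (index_enum I) => [|i s [z Az IHs]].
  by exists (a i0); rewrite // !big_nil scale0r.
rewrite !big_cons IHs; apply: convex_cone => //; exact: sumr_ge0.
Qed.

(* Apply Hahn-Banach to p z = inf {|z + t a| - t d | t >= 0, a in A}. *)
Lemma convex_norm_separation A d : convex_set A -> A !=set0 ->
  (forall a, A a -> d <= `|a|) ->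
  exists2 f : E -> R, dual_ball 1 f & forall a, A a -> d <= f a.
Proof.
move=> cA [a0 Aa0] dA.
pose S z := [set r : R | exists t a, [/\ 0 <= t, A a & r = `|z + t *: a| - t * d]].
pose p z := inf (S z).
have Sne z : S z !=set0 by exists (`|z + 0 *: a0| - 0 * d), 0, a0.
have Slb z : lbound (S z) (- `|z|).
  move=> _ [t [a [t0 Aa ->]]].
  have := lerB_normD (t *: a) z; rewrite [t *: a + z]addrC normrZ ger0_norm//.
  have := ler_wpM2l t0 (dA a Aa); lra.
have ple z t a : 0 <= t -> A a -> p z <= `|z + t *: a| - t * d.
  move=> t0 Aa; apply: ge_inf; last by exists t, a.
  by exists (- `|z|); exact: Slb.
have sp : sublinear p.
  split=> [x y|c x c0].
    rewrite -lerBlDr; apply: lb_le_inf => // _ [s [a [s_0 Aa ->]]].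
    rewrite lerBlDr -lerBlDl; apply: lb_le_inf => // _ [t [b [t_0 Ab ->]]].
    have [z Az zE] := convex_cone A a b s t cA Aa Ab s_0 t_0.
    have := ple (x + y) (s + t) z (addr_ge0 s_0 t_0) Az.
    rewrite -zE addrACA.
    have := ler_normD (x + s *: a) (y + t *: b); lra.
  move: (c0); rewrite le_eqVlt => /predU1P[<-|cp].
    rewrite scale0r mul0r; have := ple 0 0 a0 (lexx _) Aa0.
    by rewrite scale0r addr0 normr0 mul0r subr0.
  rewrite -ler_pdivrMl//; apply: lb_le_inf => // _ [s [a [s_0 Aa ->]]].
  rewrite ler_pdivrMl//; have := ple (c *: x) (c * s) a (mulr_ge0 c0 s_0) Aa.
  by rewrite -scalerA -scalerDr normrZ ger0_norm// mulrBr mulrA.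
have [f fl fp] := hahn_banach p sp.
have fZ c x : f (c *: x) = c * f x.
  have f00 : f 0 = 0 by have := fl 1 0 0; rewrite scale1r addr0; lra.
  by rewrite -[c *: x]addr0 fl f00 addr0.
have fN x : f (- x) = - f x by rewrite -scaleN1r fZ mulN1r.
have fle x : f x <= `|x|.
  apply: le_trans (fp x) _; have := ple x 0 a0 (lexx _) Aa0.
  by rewrite scale0r addr0 mul0r subr0.
exists f.
  split=> // x; rewrite mul1r ler_norml fle andbT lerNl -fN.
  by apply: le_trans (fle _) _; rewrite normrN.
(* At [- a] with [t = 1] the bound on [p] reads [f (- a) <= - d]. *)
move=> a Aa; have := ple (- a) 1 a ler01 Aa; have := fp (- a).
by rewrite scale1r addNr normr0 fN; lra.
Qed.

Lemma norming_functional x :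
  exists2 f : E -> R, dual_ball 1 f & f x = `|x|.
Proof.
have cx : convex_set [set x].
  by apply/convex_setP => _ _ t _ -> ->; rewrite -scalerDl addrC subrK scale1r.
have [||f f1 fx] := convex_norm_separation [set x] `|x| cx.
- by exists x.
- by move=> _ ->.
exists f => //; apply/eqP; rewrite eq_le fx// andbT.
exact: dual_ball_le_norm.
Qed.

Lemma convex_separation A x : closed A -> convex_set A -> A !=set0 -> ~ A x ->
  exists f d, [/\ dual_ball 1 f, 0 < d & forall a, A a -> f x + d <= f a].
Proof.
move=> clA /convex_setP cA [a0 Aa0] nAx.
have [d d0 dA] : exists2 d : R, 0 < d & forall a, A a -> d <= `|a - x|.
  have /nbhs_ballP[d d0 dA] : nbhs x (~` A).
    by apply: open_nbhs_nbhs; split => //; exact: closed_openC.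
  exists d => // a Aa; rewrite leNgt; apply/negP => axd.
  by apply: (dA a) => //; rewrite -ball_normE /= distrC.
have cB : convex_set [set a - x | a in A].
  apply/convex_setP => _ _ t t01 [a Aa <-] [b Ab <-].
  exists (t *: a + (1 - t) *: b); first exact: cA.
  rewrite !scalerBr addrACA -opprD -scalerDl.
  by rewrite (_ : t + (1 - t) = 1) ?scale1r//; ring.
have [||f f1 fd] := convex_norm_separation _ d cB.
- by exists (a0 - x), a0.
- by move=> _ [a Aa <-]; exact: dA.
exists f, d; split => // a Aa; have := fd _ (imageP (fun a => a - x) Aa).
by rewrite /= (dual_ballB 1 f a x f1) lerBrDl.
Qed.

(** Mazur's theorem: a functional separating [x] from [A] would keep the filter at distance [d] from
    its limit. *)
Lemma weak_cvg_closed_convex A (F : set_system E) {FF : ProperFilter F} x :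
  closed A -> convex_set A -> F A ->
  (forall f, dual_ball 1 f -> f @ F --> f x) -> A x.
Proof.
move=> clA cA FA Fx; apply: contrapT => nAx.
have [a Aa] := filter_ex FA.
have [f [d [f1 d0 fd]]] := convex_separation A x clA cA (ex_intro _ a Aa) nAx.
have := Fx f f1; move=> /cvgrPdist_lt/(_ d d0) Fd.
have [b [/= xb Ab]] := filter_ex (filterI Fd FA).
have := fd b Ab; move: xb; rewrite ltr_distlC => /andP[]; lra.
Qed.

Lemma weakly_compactP A : weakly_compact A <->
  forall F : set_system E, UltraFilter F -> F A ->
  exists2 x, A x & forall f, dual_ball 1 f -> f @ F --> f x.
Proof.
rewrite /weakly_compact compact_ultra; split=> cA F UF FA.
  have [x [Ax /weak_cvgP Fx]] := cA F UF FA; exists x => // f; exact: Fx.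
have [x Ax Fx] := cA F UF FA; exists x; split => //.
by apply/(@weak_cvgP R E F _ x); exact: cvg_dual_ball.
Qed.

Lemma weakly_compactI_closed_convex A B : weakly_compact A -> closed B ->
  convex_set B -> weakly_compact (A `&` B).
Proof.
move=> /weakly_compactP cA clB cB; apply/weakly_compactP => F UF FAB.
have FA : F A by apply: filterS FAB; exact: subIsetl.
have FB : F B by apply: filterS FAB; exact: subIsetr.
have [x Ax Fx] := cA F UF FA; exists x => //; split=> //.
exact: (weak_cvg_closed_convex B F).
Qed.

Lemma closed_convex_hull_closed A : closed (closed_convex_hull A).
Proof. by apply: closed_bigI => B [[clB _] _]; exact: clB. Qed.

Lemma closed_convex_hull_convex A : convex_set (closed_convex_hull A).
Proof.
apply/convex_setP => x y t t01 Ax Ay B BA.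
by have /convex_setP := BA.1.2; apply => //; [exact: Ax|exact: Ay].
Qed.

Lemma closed_convex_hull_sub A B : closed B -> convex_set B -> A `<=` B ->
  closed_convex_hull A `<=` B.
Proof. by move=> clB cB; exact: smallest_sub. Qed.

End Convex.

(** * Pták's combinatorial lemma *)

Section Ptak.
Context {R : realType} {I : Type} (chi : I -> nat -> bool).
Implicit Types (G : set I) (n N m : nat) (t : nat -> R) (e : R) (i : I).

Definition weights n N t : Prop :=
  [/\ forall m, 0 <= t m, forall m, ~~ (n <= m < N)%N -> t m = 0
    & \sum_(m < N) t m = 1].

Definition hit_mass N t i : R := \sum_(m < N) t m * (chi i m)%:R.

Definition small_mean G n e : Prop :=
  exists N t, weights n N t /\ forall i, G i -> hit_mass N t i <= e.

Definition hits n N i : Prop := exists2 m, (n <= m < N)%N & chi i m.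

Lemma sum_extend N N' t : (N <= N')%N -> (forall m, (N <= m)%N -> t m = 0) ->
  \sum_(m < N') t m = \sum_(m < N) t m.
Proof.
move=> NN' t0; rewrite -(big_mkord xpredT t) (big_cat_nat (leq0n N) NN')//=.
by rewrite big_mkord [X in _ + X]big_nat_cond [X in _ + X]big1 ?addr0// => m /andP[/andP[/t0]].
Qed.

(* Averaging p means with successive supports: a point i contributes at most 1
   in the first block it hits, nothing before, and at most e' afterwards. *)
Lemma small_mean_average G n e' p : 0 <= e' ->
  (forall n', (n <= n')%N -> small_mean (G `&` hits n n') n' e') ->
  exists N t, [/\ (n <= N)%N, forall m, 0 <= t m,
    forall m, ~~ (n <= m < N)%N -> t m = 0, \sum_(m < N) t m = p%:R
    & forall i, G i -> hit_mass N t i <= 1 + p%:R * e'].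
Proof.
move=> e'0 Gn; elim: p => [|p [N [t [nN t0 tsupp t1 ti]]]].
  exists n, (fun=> 0); split => //; first by rewrite big1.
  by move=> i _; rewrite /hit_mass big1 ?mul0r ?addr0// => m _; rewrite mul0r.
have [N' [s [[s0 ssupp s1] si]]] := Gn N nN.
have NN' : (N <= N')%N.
  rewrite leqNgt; apply/negP => N'N; move: s1; rewrite big1 => [/esym/eqP|m _].
    by rewrite oner_eq0.
  by apply: ssupp; have := ltn_ord m; lia.
exists N', (fun m => t m + s m); split.
- exact: leq_trans NN'.
- by move=> m; rewrite addr_ge0.
- by move=> m mN; rewrite tsupp ?ssupp ?addr0//; move: mN nN NN'; lia.
- rewrite big_split/= s1 (sum_extend N)// ?t1 -?natr1// => m Nm.
  by apply: tsupp; lia.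
- move=> i Gi; rewrite /hit_mass.
  under eq_bigr do rewrite mulrDl.
  rewrite big_split/= (sum_extend N N' (fun m => t m * (chi i m)%:R))//; last first.
    by move=> m Nm; rewrite tsupp ?mul0r//; lia.
  rewrite -/(hit_mass N t i) -/(hit_mass N' s i) -natr1.
  have [hi|nhi] := pselect (hits n N i).
    by have := si i (conj Gi hi); have := ti i Gi; lra.
  have -> : hit_mass N t i = 0.
    rewrite /hit_mass big1// => m _; have [nm|/negbTE nm] := boolP (n <= m)%N.
      case cm : (chi i m); last by rewrite mulr0.
      by exfalso; apply: nhi; exists m; rewrite ?nm//=.
    by rewrite tsupp ?mul0r// nm.
  have : hit_mass N' s i <= 1.
    rewrite -s1; apply: ler_sum => m _; rewrite -[leRHS]mulr1 ler_wpM2l//.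
    by case: (chi i m).
  have : 0 <= p%:R * e' by rewrite mulr_ge0.
  lra.
Qed.

(** By contraposition: if all the restricted sets had means at level [e'], averaging p of them would
    give a mean at level 1/p + e'. *)
Lemma small_mean_step G n e e' : 0 <= e' -> e' < e -> ~ small_mean G n e ->
  exists2 n', (n <= n')%N & ~ small_mean (G `&` hits n n') n' e'.
Proof.
move=> e'0 e'e nG; apply: contrapT => h; apply: nG.
have Gn n' : (n <= n')%N -> small_mean (G `&` hits n n') n' e'.
  by move=> nn'; apply: contrapT => nG'; apply: h; exists n'.
(* Chosen so that 1/p is at most [e - e']. *)
pose p := (Num.truncn (e - e')^-1).+1.
have ee'0 : 0 < e - e' by rewrite subr_gt0.
have p0 : 0 < p%:R :> R by rewrite ltr0n.
have pe : 1 <= p%:R * (e - e').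
  by rewrite -ler_pdivrMr// div1r ltW//; exact: truncnS_gt.
have [N [t [nN t0 tsupp t1 ti]]] := small_mean_average G n e' p e'0 Gn.
exists N, (fun m => p%:R^-1 * t m); split; first split.
- by move=> m; rewrite mulr_ge0// invr_ge0 ltW.
- by move=> m /tsupp ->; rewrite mulr0.
- by rewrite -mulr_sumr t1 mulVf// gt_eqF.
- move=> i Gi; rewrite /hit_mass.
  under eq_bigr do rewrite -mulrA.
  rewrite -mulr_sumr -/(hit_mass N t i) ler_pdivrMl//.
  by have := ti i Gi; lra.
Qed.

(* Pták's combinatorial lemma, with blocks [k l, k (l + 1)) instead of points. *)
Lemma ptak G e : 0 < e -> ~ small_mean G 0 e ->
  exists k : nat -> nat, forall j, exists2 i, G i &
    forall l, (l < j)%N -> hits (k l) (k l.+1) i.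
Proof.
(* Each use of [small_mean_step] lowers the level strictly, so a strictly decreasing sequence of
   positive levels is needed. *)
move=> e0 nG; pose ee j : R := e / j.+1%:R.
have ee0 j : 0 < ee j by rewrite divr_gt0 ?ltr0n.
have eeS j : ee j.+1 < ee j by rewrite ltr_pM2l// ltf_pV2 ?posrE ?ltr0n// ltr_nat.
have /choice[nx nxP] : forall a : nat * (set I * nat), exists n',
    ~ small_mean a.2.1 a.2.2 (ee a.1) ->
    ~ small_mean (a.2.1 `&` hits a.2.2 n') n' (ee a.1.+1).
  move=> [j [H n]] /=.
  have [h|h] := pselect (small_mean H n (ee j)); first by exists 0%N => /(_ h).
  have [n' _ nh] := small_mean_step H n _ _ (ltW (ee0 j.+1)) (eeS j) h.
  by exists n'.
(* The state holds the points that hit all the blocks built so far and the start of the next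
   block. *)
pose st := fix st j : set I * nat := if j is j'.+1 then
  let a := st j' in (a.1 `&` hits a.2 (nx (j', a)), nx (j', a)) else (G, 0%N).
have stP j : ~ small_mean (st j).1 (st j).2 (ee j).
  elim: j => [|j IHj]; first by rewrite /ee divr1.
  exact: (nxP (j, st j)).
have stG j i : (st j).1 i ->
    G i /\ forall l, (l < j)%N -> hits (st l).2 (st l.+1).2 i.
  elim: j i => [//|j IHj] i /= [/IHj[Gi hi] hji]; split=> // l.
  by rewrite ltnS leq_eqVlt => /predU1P[->|/hi].
exists (fun j => (st j).2) => j.
have [i /stG[Gi hi]] : (st j).1 !=set0; last by exists i.
(* Were this set empty, the point mass at [(st j).2] would be a small mean vacuously. *)
apply: contrapT => h; apply: (stP j).
exists (st j).2.+1, (fun m => (m == (st j).2)%:R); split; first split.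
- by [].
- by move=> m; case: eqP => // ->; rewrite leqnn ltnSn.
- by rewrite (bigD1 ord_max)//= eqxx big1 ?addr0// => m; rewrite -val_eqE/= => /negbTE->.
- by move=> i Gi; exfalso; apply: h; exists i.
Qed.

End Ptak.

(** * Krein's theorem *)

(** The parameters form a countable type, so [unpickle] enumerates a dense subset of the closed
    linear span of [u]. *)
Definition rat_span {R : realType} {E : normedModType R} (u : nat -> E) : set E :=
  range (fun s : seq (rat * nat) => \sum_(p <- s) ratr p.1 *: u p.2).

Section Krein.
Context {R : realType}.

Lemma dual_ball_sum {E : normedModType R} (t : nat -> R) (f : nat -> E -> R) N :
  (forall m, dual_ball 1 (f m)) ->
  dual_ball (\sum_(m < N) `|t m|) (fun x => \sum_(m < N) t m * f m x).
Proof.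
move=> f1; elim: N => [|N IHN].
  split=> [a x y|x]; first by rewrite !big_ord0; ring.
  by rewrite !big_ord0 normr0 mul0r.
have := dual_ball_lin _ _ (t N) _ _ IHN (f1 N).
rewrite mulr1 big_ord_recr/=; congr dual_ball.
by apply/funext => x; rewrite big_ord_recr.
Qed.

Lemma filter_forall_lt {T : Type} (F : set_system T) {FF : Filter F} N
  (P : nat -> set T) : (forall m, (m < N)%N -> F (P m)) ->
  F [set y | forall m, (m < N)%N -> P m y].
Proof.
elim: N => [|N IHN] FP; first by apply: filterS (@filterT _ F _) => y _ m.
apply: filterS (filterI (IHN (fun m mN => FP m (leqW mN))) (FP N (ltnSn N)))
  => y [yN PN] m; rewrite ltnS leq_eqVlt => /predU1P[->//|].
exact: yN.
Qed.

(** Classically, dominated convergence makes [f] weakly null in the space of continuous functions on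
    [K], and Mazur's theorem yields the combinations. Here Pták's lemma does so, for the relation
    [e / 2 <= |f m x|]. *)
Lemma weakly_compact_convex_null {E : normedModType R} (K : set E) (M e : R)
    (f : nat -> E -> R) : weakly_compact K -> (forall x, K x -> `|x| <= M) ->
  (forall m, dual_ball 1 (f m)) ->
  (forall x, K x -> f m x @[m --> \oo] --> 0) -> 0 < e ->
  exists N t, weights 0 N t /\
    forall x, K x -> `|\sum_(m < N) t m * f m x| <= e.
Proof.
move=> cK KM f1 f0 e0.
pose M1 : R := `|M| + 1.
have M10 : 0 < M1 by rewrite ltr_pwDr.
pose chi (x : E) m := e / 2 <= `|f m x|.
have e20 : 0 < e / 2 by rewrite divr_gt0.
have eM : 0 < e / 2 / M1 by rewrite divr_gt0.
(* Given a small mean, the indices with [|f m x| < e / 2] contribute at most e/2, and the others at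
   most [M1] times the hit mass, again e/2. *)
have [[N [t [[t0 tsupp t1] tK]]]|/(ptak chi K _ eM)[k kP]] :=
    pselect (small_mean chi K 0 (e / 2 / M1)).
  exists N, t; split => // x Kx.
  apply: (@le_trans _ _ (\sum_(m < N) (t m * (e / 2) + M1 * (t m * (chi x m)%:R)))).
    apply: le_trans (ler_norm_sum _ _ _) _; apply: ler_sum => m _.
    rewrite normrM ger0_norm// [X in _ + X]mulrCA -mulrDr ler_wpM2l//.
    rewrite /chi; have [efm|/ltW efm] := leP (e / 2) `|f m x|; last by rewrite mulr0 addr0.
    rewrite mulr1; have := (f1 m).2 x; have := KM x Kx; have := ler_norm M; rewrite mul1r /M1; lra.
  rewrite big_split/= -mulr_suml t1 -mulr_sumr.
  by have := tK x Kx; rewrite /hit_mass ler_pdivlMr//; lra.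
have kS l : (k l < k l.+1)%N.
  by have [i _ /(_ l (ltnSn l))[m mk _]] := kP l.+1; lia.
have kl l : (l <= k l)%N by elim: l => // l IHl; exact: leq_ltn_trans (kS l).
have /choice[x xP] : forall j, exists x, K x /\
    forall l, (l < j)%N -> hits chi (k l) (k l.+1) x.
  by move=> j; have [x Kx hx] := kP j; exists x.
have [U [UU xU]] := ultraFilterLemma (fmap_proper_filter x eventually_filter).
have UK : U K by apply: xU; exists 0%N => // j _; exact: (xP j).1.
have /weakly_compactP cK' := cK.
have [y Ky Uy] := cK' U UU UK.
(* Otherwise almost every point along [U] would be below e/2 on the finitely many indices of block
   [l], yet almost every point hits that block. *)
have hy l : exists2 m, (l <= m)%N & e / 2 <= `|f m y|.
  apply: contrapT => h.
  have fy m : (l <= m)%N -> U [set z | `|f m z| < e / 2].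
    move=> lm; have fme : `|f m y| < e / 2.
      by rewrite ltNge; apply/negP => ?; apply: h; exists m.
    exact: (cvgr_lt _ (cvg_norm (Uy _ (f1 m))) _ fme).
  have Ul : U (hits chi (k l) (k l.+1)).
    by apply: xU; exists l.+1 => // j; exact: (xP j).2.
  have Un : U [set z | forall m, (m < k l.+1)%N -> (l <= m)%N -> `|f m z| < e / 2].
    apply: filter_forall_lt => m _; have [lm|_] := leqP l m; last first.
      by apply: (@filterS _ U _ setT) filterT => z.
    by apply: filterS (fy m lm).
  have [z [[m /andP[km mk] em] zn]] := filter_ex (filterI Ul Un).
  have := zn m mk (leq_trans (kl l) km).
  by rewrite ltNge; move: em; rewrite /chi => ->.
have /cvgrPdist_lt/(_ _ e20)[l _ hl] := f0 y Ky.
have [m lm em] := hy l; have := hl m lm.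
by rewrite /= sub0r normrN ltNge em.
Qed.

(* One-dimensional Hahn-Banach extensions in the dual, by induction on m. *)
Lemma finite_codim_extension {E : normedModType R} (u : nat -> E) (d : R) m
    (L : (E -> R) -> R) :
  (forall r s c f g, dual_ball r f -> dual_ball s g ->
    L (fun x => f x + c * g x) = L f + c * L g) ->
  (forall r f, 0 <= r -> dual_ball r f -> (forall i, (i < m)%N -> f (u i) = 0) ->
    L f <= d * r) ->
  exists x, forall r f, 0 <= r -> dual_ball r f -> L f - f x <= d * r.
Proof.
elim: m L => [|m IHm] L Llin Ld.
  exists 0 => r f r0 fr; rewrite (dual_ball0 r f fr) subr0; exact: Ld.
pose N r f := [/\ 0 <= r, dual_ball r f & forall i, (i < m)%N -> f (u i) = 0].
(* If no such [h] exists, every functional that vanishes at the first [m] points vanishes at [u m]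
   too, and [u m] adds no constraint. *)
have [[s [h [s0 hs hN hm]]]|noh] :=
    pselect (exists s h, [/\ 0 <= s, dual_ball s h,
      forall i, (i < m)%N -> h (u i) = 0 & h (u m) = 1]); last first.
  apply: (IHm L Llin) => r f r0 fr fN; apply: Ld => // i.
  rewrite ltnS leq_eqVlt => /predU1P[->|/fN//].
  apply: contrapT => /eqP fm0; apply: noh.
  exists (`|(f (u m))^-1| * r), (fun x => (f (u m))^-1 * f x); split.
  - by rewrite mulr_ge0.
  - exact: dual_ball_scale.
  - by move=> j /fN ->; rewrite mulr0.
  - by rewrite mulVf.
(* [c] will be the coefficient of [u m]. For functionals equal to 1 at [u m] it must lie above all
   [L f - d * r] and below all [L f + d * r]; these bounds are compatible because a difference of
   two such functionals vanishes at [u m]. *)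
pose A := [set a : R | exists r f, [/\ 0 <= r, dual_ball r f,
  forall i, (i < m)%N -> f (u i) = 0, f (u m) = 1 & a = L f - d * r]].
pose c := sup A.
have Ah : A (L h - d * s) by exists s, h.
have Ale r f r' f' : 0 <= r -> dual_ball r f ->
    (forall i, (i < m)%N -> f (u i) = 0) -> f (u m) = 1 ->
    0 <= r' -> dual_ball r' f' ->
    (forall i, (i < m)%N -> f' (u i) = 0) -> f' (u m) = 1 ->
    L f - d * r <= L f' + d * r'.
  move=> r0 fr fN fm r'0 fr' fN' fm'.
  have := Ld _ _ (_ : 0 <= r + `|-1| * r') (dual_ball_lin _ _ (-1) _ _ fr fr').
  rewrite (Llin _ _ _ _ _ fr fr') normrN1 mul1r addr_ge0// => /(_ isT).
  have ffN i : (i < m.+1)%N -> f (u i) + -1 * f' (u i) = 0.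
    rewrite ltnS leq_eqVlt => /predU1P[->|im]; first by rewrite fm fm'; ring.
    by rewrite fN// fN'//; ring.
  by move=> /(_ ffN); lra.
have cge r f : 0 <= r -> dual_ball r f -> (forall i, (i < m)%N -> f (u i) = 0) ->
    f (u m) = 1 -> L f - d * r <= c.
  move=> r0 fr fN fm; apply: ub_le_sup; last by exists r, f.
  by exists (L h + d * s) => _ [r' [f' [? ? ? ? ->]]]; exact: Ale.
have cle r f : 0 <= r -> dual_ball r f -> (forall i, (i < m)%N -> f (u i) = 0) ->
    f (u m) = 1 -> c <= L f + d * r.
  move=> r0 fr fN fm; apply: ge_sup; first by exists (L h - d * s).
  by move=> _ [r' [f' [? ? ? ? ->]]]; exact: Ale.
have [||x xP] := IHm (fun f => L f - c * f (u m)).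
- by move=> r s' a f g fr gs; rewrite (Llin r s')//; ring.
- move=> r f r0 fr fN.
  have [fm|fm] := eqVneq (f (u m)) 0.
    rewrite fm mulr0 subr0; apply: Ld => // i.
    by rewrite ltnS leq_eqVlt => /predU1P[->|/fN].
  pose v := f (u m); pose g x := v^-1 * f x.
  have gr := dual_ball_scale r v^-1 f fr.
  have r'0 : 0 <= `|v^-1| * r by rewrite mulr_ge0.
  have gN i : (i < m)%N -> g (u i) = 0 by move=> /fN; rewrite /g => ->; rewrite mulr0.
  have gm : g (u m) = 1 by rewrite /g mulVf.
  have Lf : L f = v * L g.
    have z0 : dual_ball 0 (fun _ : E => 0 : R).
      by split=> [a x y|x]; [ring|rewrite normr0 mul0r].
    have L0 : L (fun=> 0) = 0.
      by have := Llin _ _ 1 _ _ z0 z0; rewrite mul1r addr0; lra.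
    rewrite -[RHS]add0r -L0 -(Llin _ _ _ _ _ z0 gr); congr L; apply/funext => x.
    by rewrite add0r mulVKf.
  have := cge _ _ r'0 gr gN gm; have := cle _ _ r'0 gr gN gm.
  rewrite -/v Lf normfV.
  (* Multiplying by [v] calls for the upper bound on [c] when [v] is negative and for the lower one
     when it is positive. *)
  have [v0|v0|v0] := ltgtP v 0; last by move: fm; rewrite -/v v0 eqxx.
    rewrite ltr0_norm// => h1 _.
    have : v * (L g + d * ((- v)^-1 * r)) <= v * c by rewrite ler_nM2l.
    rewrite mulrDr (_ : v * (d * _) = - (d * r)); last by field; rewrite lt_eqF.
    by lra.
  rewrite gtr0_norm// => _ h2.
  have : v * (L g - d * (v^-1 * r)) <= v * c by rewrite ler_pM2l.
  rewrite mulrBr (_ : v * (d * _) = d * r); last by field; rewrite gt_eqF.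
  by lra.
exists (x + c *: u m) => r f r0 fr.
rewrite (dual_ballD r f _ _ fr) (dual_ballZ r f _ _ fr).
by have := xP r f r0 fr; lra.
Qed.

Lemma cauchy_inv_cvg {E : completeNormedModType R} (x : nat -> E) :
  (forall n m, `|x n - x m| <= n.+1%:R^-1 + m.+1%:R^-1) ->
  exists l : E, x n @[n --> \oo] --> l.
Proof.
move=> xc; suff cx : cvgn x by exists (limn x).
have xe (e : R) : 0 < e ->
    exists N, forall m, (N <= m)%N -> `|x N - x m| < e.
  move=> e0; have [N Ne] : exists N, forall n, (N <= n)%N -> n.+1%:R^-1 < e / 2.
    by apply: inv_succ_lt; rewrite divr_gt0.
  exists N => m Nm; apply: le_lt_trans (xc N m) _.
  by rewrite [e]splitr ltrD// Ne.
apply: cauchy_cvg; apply: cauchy_exP => e /xe[N Ne].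
by exists (x N), N => // m /= /Ne; rewrite -ball_normE.
Qed.

Lemma ultra_image_cvg {T : Type} (U : set_system T) {UU : UltraFilter U}
  (f : T -> R) (c : R) : U [set y | `|f y| <= c] -> exists l : R, f @ U --> l.
Proof.
move=> Uc.
have [|l [_ lP]] := @segment_compact R (- c) c (f @ U)
  (fmap_proper_filter f ultra_proper).
  by apply: (@filterS _ U _ [set y | `|f y| <= c]) Uc => y; rewrite /= ler_norml in_itv.
exists l => A Al; have [//|UnA] := in_ultra_setVsetC (f @^-1` A) UU.
have [z [/= nAz Az]] := lP (~` A) A UnA Al; case: (nAz Az).
Qed.

(** A vector of the span involves finitely many [u i], so almost all [g m] kill it; the common norm
    bound carries convergence to the closure. *)
Lemma null_on_closure_rat_span {E : normedModType R} (u : nat -> E)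
    (g : nat -> E -> R) x : (forall m, dual_ball 1 (g m)) ->
  (forall m i, (i < m)%N -> g m (u i) = 0) -> closure (rat_span u) x ->
  g m x @[m --> \oo] --> 0.
Proof.
move=> g1 gu ux; apply/cvgrPdist_lt => e e0.
have [y [[s _ <-]]] := ux (ball x e) (nbhsx_ballx x e e0).
rewrite -ball_normE /= => xs.
have [N sN] : exists N, forall p, p \in s -> (p.2 < N)%N.
  exists (\max_(p <- s) p.2).+1 => p ps; rewrite ltnS.
  exact: (@leq_bigmax_seq _ _ _ (fun p : rat * nat => p.2)).
exists N => // m /= Nm; rewrite sub0r normrN; apply: le_lt_trans xs.
have gs : g m (\sum_(p <- s) ratr p.1 *: u p.2) = 0.
  rewrite big_seq; elim/big_ind: _ => [|a b ga gb|p ps].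
  - exact: dual_ball0 (g1 m).
  - by rewrite (dual_ballD _ _ _ _ (g1 m)) ga gb addr0.
  - rewrite (dual_ballZ _ _ _ _ (g1 m)) gu ?mulr0//.
    exact: leq_trans (sN p ps) Nm.
rewrite -[g m x]subr0 -gs -(dual_ballB _ _ _ _ (g1 m)).
by have := (g1 m).2 (x - \sum_(p <- s) ratr p.1 *: u p.2); rewrite mul1r.
Qed.

Lemma dual_ball_sublevel_closed {E : normedModType R} r (f : E -> R) (c : R) :
  dual_ball r f -> closed [set y | `|f y| <= c] /\ convex_set [set y | `|f y| <= c].
Proof.
move=> fr; split.
  apply: (@closed_comp _ _ (fun y => `|f y| : R^o) [set z | z <= c]); last exact: closed_le.
  move=> x _; apply: cvg_norm; exact: dual_ball_continuous fr x.
apply/convex_setP => x y t /andP[t0 t1] /= fx fy.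
rewrite fr.1 (dual_ballZ _ _ _ _ fr); apply: le_trans (ler_normD _ _) _.
rewrite !normrM (ger0_norm t0) (@ger0_norm _ (1 - t)) ?subr_ge0//.
have := ler_wpM2l t0 fx; have := ler_wpM2l (_ : 0 <= 1 - t) fy.
rewrite subr_ge0 => /(_ t1); lra.
Qed.

End Krein.

Section WeakCompactness.
Context {R : realType}.

Lemma norm_sublevel_closed {E : normedModType R} (c : R) :
  closed [set y : E | `|y| <= c] /\ convex_set [set y : E | `|y| <= c].
Proof.
split.
  apply: (@closed_comp _ _ (fun y : E => `|y| : R^o) [set z | z <= c]); last exact: closed_le.
  by move=> x _; exact: norm_continuous.
apply/convex_setP => x y t /andP[t0 t1] /= xc yc.
apply: le_trans (ler_normD _ _) _.
rewrite !normrZ (ger0_norm t0) (@ger0_norm _ (1 - t)) ?subr_ge0//.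
have := ler_wpM2l t0 xc; have := ler_wpM2l (_ : 0 <= 1 - t) yc.
rewrite subr_ge0 => /(_ t1); lra.
Qed.

Lemma cvg_inv_unique (a : nat -> R) (l l' : R) :
  (forall n, `|l - a n| <= n.+1%:R^-1) -> a n @[n --> \oo] --> l' -> l = l'.
Proof.
move=> la al'; apply: (@cvg_unique _ (@Rhausdorff R) (fmap a \oo)) => //.
apply/cvgrPdist_lt => e /inv_succ_lt[N Ne]; exists N => // n /= /Ne.
exact: le_lt_trans (la n).
Qed.

(* Krein's theorem.  A limit L of an ultrafilter on the hull, seen in the
   bidual, either is at distance 0 from E or stays > d on a sequence of unit
   functionals vanishing successively on the [u i]; the latter is excluded by
   convex combinations of these functionals that are small on K. *)
Lemma krein {E : completeNormedModType R} (K : set E) (M : R) (u : nat -> E) :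
  weakly_compact K -> (forall x, K x -> `|x| <= M) ->
  K `<=` closure (rat_span u) -> weakly_compact (closed_convex_hull K).
Proof.
move=> cK KM Ku; apply/weakly_compactP => U UU UC.
have [clM cM] := @norm_sublevel_closed E M.
have CM y : closed_convex_hull K y -> `|y| <= M.
  exact: (closed_convex_hull_sub K _ clM cM KM y).
have Ufle r f : dual_ball r f -> U [set y | `|f y| <= `|r| * M].
  move=> fr; apply: filterS UC => y /CM yM /=.
  apply: le_trans (fr.2 y) _; apply: le_trans (_ : `|r| * `|y| <= _).
    by rewrite ler_wpM2r// ler_norm.
  by rewrite ler_wpM2l.
(* An element of the bidual. [LP] justifies [lim] for bounded linear [f] only, so linearity of [L]
   is stated on dual balls. *)
pose L (f : E -> R) : R := lim (f @ U).
have LP r f : dual_ball r f -> f @ U --> L f.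
  by move=> fr; have [l /cvgP] := ultra_image_cvg U f _ (Ufle r f fr).
have Llin r s c f g : dual_ball r f -> dual_ball s g ->
    L (fun x => f x + c * g x) = L f + c * L g.
  move=> fr gs; rewrite /L; apply: cvg_lim; first exact: Rhausdorff.
  by apply: cvgD; [exact: LP fr|apply: cvgM; [exact: cvg_cst|exact: LP gs]].
have L0 : L (fun=> 0) = 0 by rewrite /L; apply: cvg_lim; [exact: Rhausdorff|exact: cvg_cst].
have LZ r c f : dual_ball r f -> L (fun x => c * f x) = c * L f.
  move=> fr; rewrite /L; apply: cvg_lim; first exact: Rhausdorff.
  by apply: cvgM; [exact: cvg_cst|exact: LP fr].
have [Lsmall|] := pselect (forall d : R, 0 < d -> exists m, forall r f, 0 <= r ->
    dual_ball r f -> (forall i, (i < m)%N -> f (u i) = 0) -> L f <= d * r).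
  have /choice[x xP] : forall n, exists x, forall r f, 0 <= r -> dual_ball r f ->
      `|L f - f x| <= n.+1%:R^-1 * r.
    move=> n; have n0 : 0 < (n.+1%:R : R)^-1 by rewrite invr_gt0 ltr0n.
    have [m mP] := Lsmall _ n0.
    have [x xP] := finite_codim_extension u _ m L Llin mP; exists x => r f r0 fr.
    (* The extension lemma bounds one side; the other comes from applying it to [- f]. *)
    rewrite ler_norml xP// andbT lerNl opprB.
    have := xP _ _ _ (dual_ball_scale _ (-1) _ fr).
    by rewrite normrN1 mul1r (LZ r)// !mulN1r opprK addrC; apply.
  have [n m|x0 xx0] := cauchy_inv_cvg x.
    have [f f1 <-] := norming_functional (x n - x m).
    rewrite (dual_ballB 1 f _ _ f1).
    have := xP n 1 f ler01 f1; have := xP m 1 f ler01 f1.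
    rewrite !mulr1 !ler_norml => /andP[]; move: (n.+1%:R^-1) (m.+1%:R^-1) => a b.
    by move=> h1 h2 /andP[h3 h4]; lra.
  have Lx0 f : dual_ball 1 f -> f @ U --> f x0.
    move=> f1; suff <- : L f = f x0 by exact: LP f1.
    apply: (cvg_inv_unique (f \o x)).
      by move=> n; have := xP n 1 f ler01 f1; rewrite mulr1.
    by apply: continuous_cvg xx0; exact: dual_ball_continuous f1 x0.
  exists x0 => //; apply: (weak_cvg_closed_convex _ U) => //.
  - exact: closed_convex_hull_closed.
  - exact: closed_convex_hull_convex.
move=> /existsNP[d /not_implyP[d0 /forallNP nL]]; exfalso.
have /choice[g gP] : forall m, exists g, [/\ dual_ball 1 g,
    forall i, (i < m)%N -> g (u i) = 0 & d <= L g].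
  move=> m; have /existsNP[r /existsNP[f /not_implyP[r0 /not_implyP[fr]]]] := nL m.
  move=> /not_implyP[fu /negP]; rewrite -ltNge => Lf.
  have rp : 0 < r.
    rewrite lt_neqAle r0 andbT eq_sym; apply/eqP => r00.
    move: Lf; rewrite r00 mulr0 (_ : f = fun=> 0) ?L0 ?ltxx//.
    apply/funext => x; apply/eqP; rewrite -normr_le0.
    by have := fr.2 x; rewrite r00 mul0r.
  exists (fun x => r^-1 * f x); split.
  - have := dual_ball_scale _ r^-1 _ fr.
    by rewrite ger0_norm ?invr_ge0 1?ltW// mulVf// gt_eqF.
  - by move=> i /fu ->; rewrite mulr0.
  - by rewrite (LZ r)// mulrC ler_pdivlMr// ltW.
have g1 m : dual_ball 1 (g m) by have [] := gP m.
have d20 : 0 < d / 2 by rewrite divr_gt0.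
have [x /Ku|N [t [[t0 _ t1] tK]]] :=
    weakly_compact_convex_null K M (d / 2) g cK KM g1 _ d20.
  by apply: null_on_closure_rat_span => // m i im; have [_ + _] := gP m; apply.
have hb n : dual_ball _ (fun x => \sum_(m < n) t m * g m x) :=
  dual_ball_sum t g n g1.
have Lh n : L (fun x => \sum_(m < n) t m * g m x) = \sum_(m < n) t m * L (g m).
  elim: n => [|n IHn].
    by rewrite big_ord0 -[RHS]L0; congr L; apply/funext => x; rewrite big_ord0.
  rewrite big_ord_recr/= -IHn -(Llin _ _ _ _ _ (hb n) (g1 n)); congr L.
  by apply/funext => x; rewrite big_ord_recr.
have [clh ch] := dual_ball_sublevel_closed _ _ (d / 2) (hb N).
have Uh : U [set y | `|\sum_(m < N) t m * g m y| <= d / 2].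
  by apply: filterS UC; exact: (closed_convex_hull_sub K _ clh ch tK).
have : L (fun x => \sum_(m < N) t m * g m x) <= d / 2.
  rewrite leNgt -subr_gt0; apply/negP => dL.
  have /cvgrPdist_lt/(_ _ dL) Ud := LP _ _ (hb N).
  have [y [/= + yd]] := filter_ex (filterI Ud Uh).
  move: yd => /=; rewrite ltr_distlC ler_norml => /andP[_ h] /andP[]; lra.
rewrite Lh; apply/negP; rewrite -ltNge.
apply: lt_le_trans (_ : d <= _); first by lra.
rewrite -[d]mul1r -t1 mulr_suml; apply: ler_sum => m _.
by rewrite ler_wpM2l//; have [] := gP m.
Qed.

Lemma fmap_ultra {T T' : Type} (h : T -> T') (U : set_system T) :
  UltraFilter U -> UltraFilter (fmap h U).
Proof.
move=> UU; split=> [|G GF hG]; first exact: fmap_proper_filter.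
apply/seteqP; split=> // A GA.
have [//|UnA] := in_ultra_setVsetC (h @^-1` A) UU.
by have [z [Az nAz]] := filter_ex (filterI GA (hG (~` A) UnA)).
Qed.

(* Grothendieck's criterion. *)
Lemma weakly_compact_approx {E : completeNormedModType R} (C : set E) :
  closed C -> convex_set C ->
  (forall e : R, 0 < e -> exists2 K, weakly_compact K &
    forall y, C y -> exists2 k, K k & `|y - k| <= e) ->
  weakly_compact C.
Proof.
move=> clC cC CK; apply/weakly_compactP => U UU UC.
(* [x n] is the weak limit of [U] pushed into [K] by a choice of close points; it approximates the
   [U]-limit uniformly over unit functionals, so these points form a Cauchy sequence. *)
have /choice[x xP] : forall n, exists x : E, forall f, dual_ball 1 f ->
    exists2 c : R, U [set y | `|f y| <= c] &
    forall l : R, f @ U --> l -> `|l - f x| <= n.+1%:R^-1.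
  move=> n; have n0 : 0 < (n.+1%:R : R)^-1 by rewrite invr_gt0 ltr0n.
  have [K /weakly_compactP cK KC] := CK _ n0.
  have /choice[k kP] : forall y, exists k, C y -> K k /\ `|y - k| <= n.+1%:R^-1.
    move=> y; have [/KC[k Kk yk]|nCy] := pselect (C y); first by exists k.
    by exists y.
  have [|x Kx Ux] := cK (fmap k U) (fmap_ultra k U UU).
    by apply: (@filterS _ U _ C) UC => y Cy; exact: (kP y Cy).1.
  have fk f y : dual_ball 1 f -> C y -> `|f y - f (k y)| <= n.+1%:R^-1.
    move=> f1 /kP[_ yk]; rewrite -(dual_ballB 1 f _ _ f1).
    by apply: le_trans (f1.2 _) _; rewrite mul1r.
  (* [C] is not assumed bounded: the bound on [f] along [U], needed for a limit to exist, goes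
     through [f (k y)] and [f x]. *)
  exists x => f f1; exists (n.+1%:R^-1 + (1 + `|f x|)).
    have Ud : U [set y | `|f x - f (k y)| <= 1].
      by have /cvgrPdist_le/(_ _ ltr01) := Ux f f1.
    apply: filterS (filterI Ud UC) => y [/= fxy Cy].
    apply: le_trans (_ : `|(f y - f (k y)) + ((f (k y) - f x) + f x)| <= _).
      by rewrite !subrK.
    rewrite (le_trans (ler_normD _ _))// lerD//; first exact: fk.
    by rewrite (le_trans (ler_normD _ _))// lerD// distrC.
  move=> l Ul; apply: (@closed_cvg _ _ U _ (fun y => f y - f (k y))
    [set z : R^o | `|z| <= n.+1%:R^-1]).
  - apply: (@closed_comp _ _ (fun y : R^o => `|y|) [set z | z <= _]).
      by move=> z _; exact: norm_continuous.
    exact: closed_le.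
  - by apply: filterS UC => y /= Cy; exact: fk.
  - by apply: cvgB => //; exact: Ux _ f1.
have Uf f : dual_ball 1 f -> exists l : R, f @ U --> l.
  by move=> f1; have [c Uc _] := xP 0%N f f1; exact: (ultra_image_cvg U f c).
have [n m|x0 xx0] := cauchy_inv_cvg x.
  have [f f1 <-] := norming_functional (x n - x m).
  have [l Ul] := Uf f f1; rewrite (dual_ballB 1 f _ _ f1).
  have [_ _ /(_ l Ul)] := xP n f f1; have [_ _ /(_ l Ul)] := xP m f f1.
  rewrite !ler_norml; move: (n.+1%:R^-1) (m.+1%:R^-1) => a b.
  by move=> /andP[h1 h2] /andP[h3 h4]; lra.
have Ux0 f : dual_ball 1 f -> f @ U --> f x0.
  move=> f1; have [l Ul] := Uf f f1; suff <- : l = f x0 by [].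
  apply: (cvg_inv_unique (f \o x)).
    by move=> n; have [_ _ /(_ l Ul)] := xP n f f1.
  by apply: continuous_cvg xx0; exact: dual_ball_continuous f1 x0.
by exists x0 => //; exact: (weak_cvg_closed_convex _ U).
Qed.

End WeakCompactness.

(** * Eberlein's theorem *)

Section Eberlein.
Context {R : realType}.

Lemma increasing_extract (P : nat -> nat -> Prop) :
  (forall k N, exists2 n, (N <= n)%N & P k n) ->
  exists2 phi : nat -> nat, increasing_seq phi & forall k, P k (phi k).
Proof.
move=> Pn; have /choice[h hP] : forall a : nat * nat, exists n,
    (a.2 <= n)%N /\ P a.1 n.
  by move=> [k N]; have [n Nn Pkn] := Pn k N; exists n.
pose phi := fix phi k := if k is k'.+1 then h (k, (phi k').+1) else h (0%N, 0%N).
exists phi; last first.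
  by case=> [|k]; [exact: (hP (0, 0)%N).2|exact: (hP (k.+1, (phi k).+1)).2].
by apply/increasing_seqP => k; exact: (hP (k.+1, (phi k).+1)).1.
Qed.

Lemma increasing_seq_ge (phi : nat -> nat) n : increasing_seq phi -> (n <= phi n)%N.
Proof.
move=> /increasing_seqP phiS; elim: n => // n IHn.
exact: leq_ltn_trans IHn (phiS n).
Qed.

Lemma cvg_increasing {T : topologicalType} (phi : nat -> nat) (u : nat -> T) (l : T) :
  increasing_seq phi -> u n @[n --> \oo] --> l -> u (phi n) @[n --> \oo] --> l.
Proof.
move=> iphi ul; apply: (cvg_comp phi u) ul.
move=> A [N _ NA]; exists N => // n /= Nn; apply: NA => /=.
exact: leq_trans (increasing_seq_ge phi n iphi).
Qed.

Lemma rat_span_gen {E : normedModType R} (u : nat -> E) n : rat_span u (u n).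
Proof. by exists [:: (1, n)] => //; rewrite big_seq1 /= rmorph1 scale1r. Qed.

Lemma rat_span_lin {E : normedModType R} (u : nat -> E) (q : rat) x y :
  rat_span u x -> rat_span u y -> rat_span u (ratr q *: x + y).
Proof.
move=> [s _ <-] [t _ <-]; exists ([seq (q * p.1, p.2) | p <- s] ++ t) => //.
rewrite big_cat big_map /= scaler_sumr; congr (_ + _).
by apply: eq_bigr => p _; rewrite rmorphM scalerA.
Qed.

Lemma closure_rat_convex {E : normedModType R} (D : set E) :
  (forall (q : rat) x y, 0 <= q <= 1 -> D x -> D y ->
    D (ratr q *: x + (1 - ratr q) *: y)) ->
  convex_set (closure D).
Proof.
move=> Dq; apply/convex_setP => x y t /andP[t0 t1] Dx Dy.
(* The case [t = 0] is apart because the rational coefficient is taken strictly between 0 and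
   [t]. *)
have [->|tn0] := eqVneq t 0; first by rewrite scale0r add0r subr0 scale1r.
have tp : 0 < t by rewrite lt_neqAle eq_sym tn0.
move=> A /nbhs_ballP[e /= e0 eA].
pose e3 : R := e / 3.
have e30 : 0 < e3 by rewrite divr_gt0.
pose c : R := `|x| + `|y| + 1.
have c0 : 0 < c by rewrite ltr_wpDl// addr_ge0.
(* With [t - q < e3 / c], replacing [t] by [q] costs less than e/3, and replacing the points costs
   at most another e/3. *)
have : Num.max 0 (t - e3 / c) < t by rewrite gt_max tp ltrBlDr ltrDl divr_gt0.
move=> /rat_in_itvoo[q]; rewrite in_itv/= gt_max => /andP[/andP[q0 tq] qt].
have q01 : 0 <= q <= 1.
  have := ltW (lt_le_trans qt t1); rewrite -(rmorph1 (@ratr R)) ler_rat => ->.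
  by move: q0; rewrite ltr0q => /ltW ->.
have [a [Da]] := Dx (ball x e3) (nbhsx_ballx x e3 e30).
have [b [Db]] := Dy (ball y e3) (nbhsx_ballx y e3 e30).
rewrite -!ball_normE /= => yb xa.
exists (ratr q *: a + (1 - ratr q) *: b); split; first exact: Dq.
apply: eA; rewrite -ball_normE /=.
have r0 : 0 <= (ratr q : R) by rewrite ler0q; case/andP: q01.
have r1 : (ratr q : R) <= 1.
  by rewrite -(rmorph1 (@ratr R)) ler_rat; case/andP: q01.
move: (ratr q : R) tq qt r0 r1 => r tr rt r0 r1.
rewrite opprD addrACA; apply: le_lt_trans (ler_normD _ _) _.
have h1 : `|t *: x - r *: a| <= (t - r) * `|x| + r * `|x - a|.
  apply: le_trans (ler_distD (r *: x) _ _) _.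
  by rewrite -scalerBl -scalerBr !normrZ !ger0_norm// subr_ge0 ltW.
have h2 : `|(1 - t) *: y - (1 - r) *: b| <= (t - r) * `|y| + (1 - r) * `|y - b|.
  apply: le_trans (ler_distD ((1 - r) *: y) _ _) _.
  rewrite -scalerBl -scalerBr !normrZ (@ger0_norm _ (1 - r)) ?subr_ge0//.
  rewrite (_ : 1 - t - (1 - r) = - (t - r)); last by ring.
  by rewrite normrN ger0_norm// subr_ge0 ltW.
have h3 : (t - r) * c < e3 by rewrite -ltr_pdivlMr//; lra.
have h4 : r * `|x - a| <= r * e3 by rewrite ler_wpM2l// ltW.
have h5 : (1 - r) * `|y - b| <= (1 - r) * e3 by rewrite ler_wpM2l ?subr_ge0// ltW.
have : 0 < t - r by rewrite subr_gt0.
move: h1 h2 h3 h4 h5; rewrite /c /e3; lra.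
Qed.

Lemma closure_rat_span_convex {E : normedModType R} (u : nat -> E) :
  convex_set (closure (rat_span u)).
Proof.
apply: closure_rat_convex => q x y _ ux uy.
have u0 : rat_span u 0 by exists [::] => //; rewrite big_nil.
apply: rat_span_lin => //.
have := rat_span_lin u (1 - q) y 0 uy u0.
by rewrite addr0 rmorphB rmorph1.
Qed.

(** Take a norming functional at each vector of the countable span: if [x] and [y] differ, the one
    at a span vector close to [x - y] distinguishes them. *)
Lemma separating_functionals {E : normedModType R} (u : nat -> E) :
  exists2 g : nat -> E -> R, forall n, dual_ball 1 (g n) &
    forall x y, closure (rat_span u) x -> closure (rat_span u) y ->
      (forall n, g n x = g n y) -> x = y.
Proof.
pose v n : E := oapp (fun s : seq (rat * nat) => \sum_(p <- s) ratr p.1 *: u p.2)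
  0 (unpickle n).
have /choice[g gP] : forall n, exists g, dual_ball 1 g /\ g (v n) = `|v n|.
  by move=> n; have [g g1 gv] := norming_functional (v n); exists g.
exists g => [n|x y ux uy gxy]; first exact: (gP n).1.
apply: contrapT => /eqP; rewrite -subr_eq0 -normr_gt0 => xy.
(* If all [g n] agree on [x] and [y], then [|a - b|] is at most the sum of the two errors, and
   [|x - y|] at most twice that sum; a quarter makes this strictly less than [|x - y|]. *)
have e0 : 0 < `|x - y| / 4 by rewrite divr_gt0.
have [a [ua]] := ux (ball x _) (nbhsx_ballx x _ e0).
have [b [ub]] := uy (ball y _) (nbhsx_ballx y _ e0).
rewrite -!ball_normE /= => yb xa.
have [s _ sE] : rat_span u (a - b).
  have := rat_span_lin u (-1) b a ub ua.
  by rewrite rmorphN1 scaleN1r addrC.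
have vE : v (pickle s) = a - b by rewrite /v pickleK.
have [g1 gv] := gP (pickle s).
have gab : g (pickle s) (a - b) <= `|x - a| + `|y - b|.
  have := dual_ball_le_norm _ (a - x) g1; have := dual_ball_le_norm _ (y - b) g1.
  rewrite !(dual_ballB _ _ _ _ g1) gxy (distrC a x); lra.
have xyab : `|x - y| <= `|x - a| + `|a - b| + `|y - b|.
  by have := ler_distD a x y; have := ler_distD b a y; rewrite (distrC b y); lra.
by move: gab; rewrite -vE gv vE; lra.
Qed.

(* The sequential half of the Eberlein-Smulian theorem. *)
Lemma weakly_compact_sequential {E : normedModType R} (K : set E) (u : nat -> E) :
  weakly_compact K -> (forall n, K (u n)) ->
  exists2 phi : nat -> nat, increasing_seq phi &
    exists2 x, K x & weak_cvg_to (u \o phi) x.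
Proof.
move=> cK Ku; have [g g1 gsep] := separating_functionals u.
(* On this part of [K] the countably many [g n] separate points. *)
pose K' := K `&` closure (rat_span u).
have /weakly_compactP cK' : weakly_compact K'.
  apply: weakly_compactI_closed_convex => //; first exact: closed_closure.
  exact: closure_rat_span_convex.
have K'u n : K' (u n).
  by split; [exact: Ku|apply: subset_closure; exact: (rat_span_gen u n)].
have [U [UU uU]] := ultraFilterLemma (fmap_proper_filter u eventually_filter).
have [|x [Kx ux] Ux] := cK' U UU; first by apply: uU; exists 0%N => // n _; exact: K'u.
have [phi iphi gphi] : exists2 phi, increasing_seq phi & forall k, forall i,
    (i < k)%N -> `|g i x - g i (u (phi k))| < k.+1%:R^-1.
  apply: (increasing_extract (fun k n => forall i, (i < k)%N ->
    `|g i x - g i (u n)| < k.+1%:R^-1)) => k N.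
  have k0 : 0 < (k.+1%:R : R)^-1 by rewrite invr_gt0 ltr0n.
  have Uk : U [set y | forall i, (i < k)%N -> `|g i x - g i y| < k.+1%:R^-1].
    by apply: filter_forall_lt => i _; have /cvgrPdist_lt/(_ _ k0) := Ux _ (g1 i).
  have UN : U [set u n | n in [set n | (N <= n)%N]].
    by apply: uU; exists N => // n Nn; exists n.
  by have [y [yk [n Nn ny]]] := filter_ex (filterI Uk UN); exists n => //; rewrite ny.
have gcvg i : g i (u (phi k)) @[k --> \oo] --> g i x.
  apply/cvgrPdist_lt => e /inv_succ_lt[N Ne].
  exists (maxn i.+1 N) => // k /=; rewrite geq_max => /andP[ik /Ne].
  exact: lt_trans (gphi k i ik).
exists phi => //; exists x => //; apply/weak_cvg_seqP => f f1.
apply: contrapT => nf.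
have [e e0 /choice[psi psiP]] : exists2 e : R, 0 < e & forall N, exists n,
    (N <= n)%N /\ e <= `|f x - f (u (phi n))|.
  apply: contrapT => h; apply: nf; apply/cvgrPdist_lt => e e0.
  apply: contrapT => nN; apply: h; exists e => // N.
  apply: contrapT => hN; apply: nN; exists N => // n /= Nn.
  by rewrite ltNge; apply/negP => en; apply: hN; exists n.
(* A weak cluster point [y] of the subsequence along which [f] stays away from [f x] has the same
   [g i] values as [x], hence equals [x]. *)
have [V [VV uV]] := ultraFilterLemma
  (fmap_proper_filter (u \o phi \o psi) eventually_filter).
have [|y [Ky uy] Vy] := cK' V VV; first by apply: uV; exists 0%N => // n _; exact: K'u.
have psioo : psi @ \oo --> \oo.
  by move=> A [N _ NA]; exists N => // n /= Nn; apply: NA; exact: leq_trans (psiP n).1.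
have xy : x = y.
  apply: gsep => // i; apply: (@cvg_unique _ (@Rhausdorff R) (g i @ V)).
    by move=> A /(cvg_comp psi _ psioo (gcvg i)); exact: uV.
  exact: Vy.
have Ve : V [set z | e <= `|f x - f z|] by apply: uV; exists 0%N => // n _; exact: (psiP n).2.
have /cvgrPdist_lt/(_ _ e0) Vf := Vy f f1.
by have [z [/= ez]] := filter_ex (filterI Ve Vf); rewrite /= -xy ltNge ez.
Qed.

End Eberlein.

(** * The De Blasi measure of a convex orbit *)

Section DeBlasi.
Context {R : realType}.

Lemma bounded_setP {E : normedModType R} (A : set E) :
  bounded_set A <-> exists M : R, forall x, A x -> `|x| <= M.
Proof.
split=> [/pinfty_ex_gt0[M _ AM]|[M AM]]; first by exists M.
exists M; split; first exact: num_real.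
by move=> N MN x /AM xM; exact: le_trans xM (ltW MN).
Qed.

Inductive orbit_hull {E : normedModType R} (x0 : E) (b : E -> E) : E -> Prop :=
| orbit_hull_base : orbit_hull x0 b x0
| orbit_hull_map w : orbit_hull x0 b w -> orbit_hull x0 b (b w)
| orbit_hull_conv (q : rat) x y : 0 <= q <= 1 -> orbit_hull x0 b x ->
    orbit_hull x0 b y -> orbit_hull x0 b (ratr q *: x + (1 - ratr q) *: y).

(** Derivations of membership in the hull are coded by trees over [rat], a countable type; every
    other shape is sent to [x0]. *)
Fixpoint orbit_tree {E : normedModType R} (x0 : E) (b : E -> E)
    (t : GenTree.tree rat) : E :=
  match t with
  | GenTree.Node 0 [:: t1] => b (orbit_tree x0 b t1)
  | GenTree.Node _.+1 [:: GenTree.Leaf q; t1; t2] =>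
      ratr q *: orbit_tree x0 b t1 + (1 - ratr q) *: orbit_tree x0 b t2
  | _ => x0
  end.

Lemma orbit_hull_enum {E : normedModType R} (x0 : E) (b : E -> E) :
  exists u : nat -> E, orbit_hull x0 b = range u.
Proof.
pose v n := oapp (orbit_tree x0 b) x0 (unpickle n).
(* A tree may carry a rational outside [0, 1], so [v n] can leave the hull; [x0] then takes its
   place. *)
have /choice[u uP] : forall n, exists y, orbit_hull x0 b y /\
    (orbit_hull x0 b (v n) -> y = v n).
  move=> n; have [h|h] := pselect (orbit_hull x0 b (v n)); first by exists (v n).
  by exists x0; split => //; exact: orbit_hull_base.
exists u; apply/seteqP; split=> [x hx|_ [n _ <-]]; last exact: (uP n).1.
have [t tx] : exists t, orbit_tree x0 b t = x.
  elim: hx => [|w _ [t <-]|q y z _ _ [t <-] _ [s <-]].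
  - by exists (GenTree.Leaf 0).
  - by exists (GenTree.Node 0 [:: t]).
  - by exists (GenTree.Node 1 [:: GenTree.Leaf q; t; s]).
have vx : v (pickle t) = x by rewrite /v pickleK.
by exists (pickle t) => //; rewrite (uP _).2 vx.
Qed.

Lemma closure_orbit_hull_convex {E : normedModType R} (x0 : E) (b : E -> E) :
  convex_set (closure (orbit_hull x0 b)).
Proof. by apply: closure_rat_convex => q x y q01; exact: orbit_hull_conv. Qed.

Definition weakly_compact_within {E : normedModType R} (W : set E) (e : R) : Prop :=
  0 < e /\ exists2 K, weakly_compact K &
    forall w, W w -> exists2 k, K k & `|w - k| <= e.

Lemma deBlasiE {E : normedModType R} (W : set E) :
  deBlasi W = inf (weakly_compact_within W).
Proof.
rewrite /deBlasi; congr inf; apply/seteqP; split=> e /= [e0 [K cK WK]].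
  split=> //; exists K => // w /WK[k Kk [y]].
  rewrite closed_ballE// /closed_ball_ /= sub0r normrN => ye <-.
  by exists k => //; rewrite addrAC subrr add0r.
split=> //; exists K => // w /WK[k Kk wk]; exists k => //; exists (w - k).
  by rewrite closed_ballE// /closed_ball_ /= sub0r normrN.
by rewrite addrC subrK.
Qed.

Lemma deBlasi_ge0 {E : normedModType R} (W : set E) : 0 <= deBlasi W.
Proof.
rewrite deBlasiE; have [->|/set0P Wne] := eqVneq (weakly_compact_within W) set0.
  by rewrite inf0.
by apply: lb_le_inf => // e [/ltW].
Qed.

Lemma weakly_compact1 {E : normedModType R} (x : E) : weakly_compact [set x].
Proof. exact: (@compact_set1 (weak_topology E)). Qed.

Lemma weakly_compact_within_neq0 {E : normedModType R} (W : set E) :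
  bounded_set W -> weakly_compact_within W !=set0.
Proof.
move=> /bounded_setP[M WM]; exists (`|M| + 1); split; first by rewrite ltr_pwDr.
exists [set 0]; first exact: weakly_compact1.
move=> w /WM wM; exists 0 => //; rewrite subr0 (le_trans wM)//.
by rewrite (le_trans (ler_norm _))// lerDl.
Qed.

(** The map w -> c b(w) + (1 - c) x0 shrinks the distance to [K] by the factor [c], [x0] is
    approximated exactly, and convex combinations keep the bound once [K] is replaced by a hull,
    which Krein's theorem keeps weakly compact. *)
Lemma orbit_hull_within {E : completeNormedModType R} (x0 : E) (c : R) (b : E -> E)
    (V : set E) (e : R) :
  0 < c < 1 -> bounded_set V ->
  (forall w, orbit_hull x0 (fun w => c *: b w + (1 - c) *: x0) w -> V (b w)) ->
  weakly_compact_within V e ->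
  weakly_compact_within (orbit_hull x0 (fun w => c *: b w + (1 - c) *: x0)) (c * e).
Proof.
set W := orbit_hull _ _ => /andP[c0 c1] /bounded_setP[M VM] bV [e0 [K cK VK]].
split; first by rewrite mulr_gt0.
have [u Wu] := orbit_hull_enum x0 (fun w => c *: b w + (1 - c) *: x0).
have Wun n : W (u n) by rewrite /W Wu; exists n.
have /choice[k kP] : forall n, exists k, K k /\ `|b (u n) - k| <= e.
  by move=> n; have [k Kk bk] := VK _ (bV _ (Wun n)); exists k.
pose v n := if n is m.+1 then k m else x0.
pose M' := `|x0| + (`|M| + e).
have vM n : `|v n| <= M'.
  rewrite /M'; case: n => [|n] /=; first by rewrite lerDl addr_ge0// ltW.
  have [_ bk] := kP n; have := VM _ (bV _ (Wun n)).
  have := ler_distD (b (u n)) (k n) 0; rewrite !subr0 distrC.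
  have := normr_ge0 x0; have := ler_norm M; lra.
have [clM cM] := @norm_sublevel_closed R E M'.
(* Krein's theorem requires a norm bound and a separable span, so only the part of [K] near the
   chosen points is retained. *)
pose K1 := ((K `|` [set x0]) `&` closure (rat_span v)) `&` [set y | `|y| <= M'].
have K1v n : K1 (v n).
  split; last exact: vM; split; last by apply: subset_closure; exact: (rat_span_gen v n).
  by case: n => [|n]; [right|left; exact: (kP n).1].
have cK1 : weakly_compact K1.
  apply: weakly_compactI_closed_convex => //.
  apply: weakly_compactI_closed_convex; last 2 first.
  - exact: closed_closure.
  - exact: closure_rat_span_convex.
  - exact: (@compactU (weak_topology E) _ _ cK (weakly_compact1 x0)).
exists (closed_convex_hull K1).
  apply: (krein K1 M' v) => //; first by move=> x [].
  by move=> x [[]].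
have /convex_setP cH := closed_convex_hull_convex K1.
have Hv n : closed_convex_hull K1 (v n) by move=> A [_]; apply; exact: K1v.
move=> w; elim => [|{}w Ww _|q x y /andP[q0 q1] _ [h Hh xh] _ [h' Hh' yh']].
- by exists x0; [exact: (Hv 0%N)|rewrite subrr normr0 mulr_ge0// ltW].
- move: Ww; rewrite -/W /W Wu => -[n _ <-].
  exists (c *: k n + (1 - c) *: x0).
    by apply: cH; rewrite ?(ltW c0) ?(ltW c1)//; [exact: (Hv n.+1)|exact: (Hv 0%N)].
  rewrite opprD addrACA subrr addr0 -scalerBr normrZ gtr0_norm// ler_pM2l//.
  exact: (kP n).2.
- have r0 : 0 <= (ratr q : R) by rewrite ler0q.
  have r1 : (ratr q : R) <= 1 by rewrite -(rmorph1 (@ratr R)) ler_rat.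
  move: (ratr q : R) r0 r1 => r r0 r1.
  exists (r *: h + (1 - r) *: h'); first by apply: cH; rewrite ?r0.
  rewrite opprD addrACA -!scalerBr; apply: le_trans (ler_normD _ _) _.
  rewrite !normrZ (ger0_norm r0) (@ger0_norm _ (1 - _)) ?subr_ge0//.
  have := ler_wpM2l r0 xh; have := ler_wpM2l (_ : 0 <= 1 - r) yh'.
  by rewrite subr_ge0 => /(_ r1); lra.
Qed.

Lemma orbit_hull_weakly_compact {E : completeNormedModType R} (x0 : E) (c : R)
    (b : E -> E) (V : set E)
    (W := orbit_hull x0 (fun w => c *: b w + (1 - c) *: x0)) :
  0 < c < 1 -> bounded_set V -> (forall w, W w -> V (b w)) ->
  deBlasi V <= deBlasi W -> weakly_compact (closure W).
Proof.
move=> c01 bdV bV VW; have /andP[c0 c1] := c01.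
have lbW V' : has_lbound (@weakly_compact_within E V').
  by exists 0 => e [/ltW].
(* An empty set would have infimum 0 by convention; nonemptiness is what turns measure zero into
   actual approximations. *)
have Wne : weakly_compact_within W !=set0.
  have [e Ve] := weakly_compact_within_neq0 V bdV.
  by exists (c * e); exact: orbit_hull_within Ve.
have W0 : deBlasi W <= 0.
  have h : c^-1 * deBlasi W <= deBlasi V.
    rewrite (deBlasiE V); apply: lb_le_inf; first exact: weakly_compact_within_neq0.
    move=> e Ve; rewrite ler_pdivrMl// deBlasiE; apply: ge_inf => //.
    exact: orbit_hull_within Ve.
  move: (le_trans h VW); rewrite ler_pdivrMl//; have := deBlasi_ge0 W; nra.
apply: weakly_compact_approx.
- exact: closed_closure.
- exact: closure_orbit_hull_convex.
move=> e e0; have e20 : 0 < e / 2 by rewrite divr_gt0.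
have [r [r0 [K cK WK]] re] : exists2 r, weakly_compact_within W r & r < e / 2.
  have /inf_adherent : has_inf (weakly_compact_within W) by split.
  move=> /(_ _ e20)[r Wr]; rewrite -deBlasiE => re; exists r => //; lra.
exists K => // y Wy; have [w [Ww]] := Wy _ (nbhsx_ballx y _ e20).
rewrite -ball_normE /= => yw; have [k Kk wk] := WK w Ww; exists k => //.
by have := ler_distD w y k; lra.
Qed.

End DeBlasi.

(** * Scarf's lemma *)

Section Scarf.
Import fintype finset.
Local Open Scope nat_scope.
Local Open Scope set_scope.
Context {T I : finType} (key : I -> T -> nat).
Context (key_inj : forall i, injective (key i)).
Implicit Types (X Y : {set T}) (x y z : T) (i j : I).

(** Scarf's dominating sets: they act as the simplices of a triangulation, with the orders [key i]
    in place of geometry. *)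
Definition dominant X : bool :=
  [forall y, exists i, forall x in X, key i y <= key i x].

Lemma dominantP X : reflect
  (forall y, exists i, forall x, x \in X -> key i y <= key i x) (dominant X).
Proof.
apply: (iffP forallP) => h y.
  by have /existsP[i /forall_inP hi] := h y; exists i.
by have [i hi] := h y; apply/existsP; exists i; apply/forall_inP.
Qed.

Lemma dominantS X Y : Y \subset X -> dominant X -> dominant Y.
Proof.
move=> /subsetP YX /dominantP dX; apply/dominantP => y.
by have [i hi] := dX y; exists i => x /YX /hi.
Qed.

Definition extensions Y := [set y | (y \notin Y) && dominant (y |: Y)].

Section Extensions.
Context {Y : {set T}} {mn : I -> T}.
Context (Ydom : dominant Y) (Ycard : #|I| = #|Y|.+1)
  (mnY : forall i, mn i \in Y)
  (mn_min : forall i y, y \in Y -> key i (mn i) <= key i y).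

(** Adding such a point to [Y] leaves the minimum of every index other than [j] in place. *)
Definition strictly_above j :=
  [set y | [forall i, (i != j) ==> (key i (mn i) < key i y)]].

Lemma strictly_aboveP j y : reflect
  (forall i, i != j -> key i (mn i) < key i y) (y \in strictly_above j).
Proof.
rewrite inE; apply: (iffP forallP) => h i; last by apply/implyP; exact: h.
by apply/implyP; exact: h.
Qed.

Lemma mn_unique i y : y \in Y -> (forall x, x \in Y -> key i y <= key i x) ->
  y = mn i.
Proof.
move=> Yy ymin; apply: (key_inj i); apply/eqP.
by rewrite eqn_leq mn_min// ymin// mnY.
Qed.

Lemma mn_surj : mn @: [set: I] = Y.
Proof.
apply/eqP; rewrite finset.eqEsubset; apply/andP; split; apply/subsetP => y.
  by move=> /imsetP[i _ ->].
move=> Yy; have /dominantP /(_ y)[i hi] := Ydom.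
by rewrite (mn_unique i y Yy hi) imset_f.
Qed.

Lemma mn_collision : exists i1 i2, i1 != i2 /\ mn i1 = mn i2.
Proof.
have /injectivePn[i1 [i2 ne e]] : ~~ injectiveb mn.
  apply/negP => /injectiveP mninj.
  by have := card_imset [set: I] mninj; rewrite mn_surj cardsT Ycard => /n_Sn.
by exists i1, i2.
Qed.

Lemma mn_imset_setC1 i1 i2 : i1 != i2 -> mn i1 = mn i2 -> mn @: [set~ i1] = Y.
Proof.
move=> ne e; rewrite -mn_surj; apply/eqP; rewrite finset.eqEsubset imsetS ?subsetT//=.
apply/subsetP => _ /imsetP[i _ ->]; have [->|ni] := eqVneq i i1.
  by rewrite e imset_f// !inE eq_sym.
by rewrite imset_f// !inE.
Qed.

(** Dominance at [y] makes it the new minimum of some index [j]. All of [Y] must still consist of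
    minima of the remaining indices, so [j] is one of the two indices that share a minimum. *)
Lemma extensions_sub i1 i2 y : i1 != i2 -> mn i1 = mn i2 ->
  y \in extensions Y -> exists2 j, j \in [set i1; i2] &
    y \in strictly_above j /\
    forall z, z \in strictly_above j -> key j z <= key j y.
Proof.
move=> ne e; rewrite inE => /andP[nYy dX]; have /dominantP dX' := dX.
have [j hj] := dX' y.
have jy x : x \in Y -> key j y < key j x.
  move=> Yx; rewrite ltn_neqAle hj ?inE ?Yx ?orbT// andbT.
  by apply/eqP => /key_inj yx; rewrite yx Yx in nYy.
(* Otherwise [Y] would consist of minima of indices other than [i] and [j], which are too few. *)
have cover i : i != j -> key i y <= key i (mn i) -> False.
  move=> nij yi; have : mn @: ([set: I] :\ i :\ j) = Y.
    apply/eqP; rewrite -[X in _ == X]mn_surj finset.eqEsubset imsetS ?subsetT//=.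
    rewrite mn_surj; apply/subsetP => x Yx.
    have [k hk] := dX' x.
    have xk : x = mn k by apply: mn_unique => // x' Yx'; rewrite hk// !inE Yx' orbT.
    rewrite xk imset_f// !inE andbT; apply/andP; split; apply/eqP => kE.
      have := hk y; rewrite !inE eqxx => /(_ isT).
      by rewrite kE leqNgt jy.
    have := hk y; rewrite !inE eqxx => /(_ isT) h.
    have xy : x = y.
      apply: (key_inj k); apply/eqP; rewrite eqn_leq h xk kE yi.
      by [].
    by rewrite xy in Yx; rewrite Yx in nYy.
  move=> /(congr1 (fun A : {set T} => #|A|)) cE.
  have := leq_imset_card mn ([set: I] :\ i :\ j); rewrite cE.
  have := cardsD1 j ([set: I] :\ i); have := cardsD1 i [set: I].
  rewrite !inE eq_sym nij cardsT Ycard /=; lia.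
exists j.
  have jC : mn @: [set~ j] = Y.
    apply/eqP; rewrite -[X in _ == X]mn_surj finset.eqEsubset imsetS ?subsetT//=.
    rewrite mn_surj; apply/subsetP => x Yx.
    have [k hk] := dX' x.
    have xk : x = mn k by apply: mn_unique => // x' Yx'; rewrite hk// !inE Yx' orbT.
    rewrite xk imset_f// !inE; apply/eqP => kE.
    have := hk y; rewrite !inE eqxx => /(_ isT).
    by rewrite kE leqNgt jy.
  (* Without [j] there are as many indices as elements of [Y], so the collision between [i1] and
     [i2] must involve [j]. *)
  have inj : {in [set~ j] &, injective mn}.
    by apply/imset_injP; rewrite jC cardsC1 Ycard.
  rewrite !inE; apply: contraT; rewrite negb_or => /andP[j1 j2].
  have := inj i1 i2; rewrite !inE eq_sym j1 eq_sym j2 => /(_ isT isT e) /eqP.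
  by rewrite (negbTE ne).
split.
  apply/strictly_aboveP => i ij; rewrite ltnNge; apply/negP; exact: cover.
move=> z /strictly_aboveP zj; have [i hi] := dX' z.
have [<-|ij] := eqVneq i j; first by rewrite hi// !inE eqxx.
by have := zj i ij; rewrite ltnNge hi// !inE mnY orbT.
Qed.

(** A point strictly above all minima except that of [j] is dominated at [j] by maximality of [y];
    any other point is dominated at the index where it fails. *)
Lemma extensions_sup j1 j y : j1 != j -> mn j1 = mn j ->
  y \in strictly_above j ->
  (forall z, z \in strictly_above j -> key j z <= key j y) -> y \in extensions Y.
Proof.
move=> ne e /strictly_aboveP yj ymax; rewrite inE; apply/andP; split.
  apply/negP => Yy; rewrite eq_sym in ne.
  move: (Yy); rewrite -(mn_imset_setC1 _ _ ne (esym e)) => /imsetP[i].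
  by rewrite !inE => /yj + yi; rewrite yi ltnn.
have jy x : x \in Y -> key j y <= key j x.
  have /dominantP /(_ y)[i hi] := Ydom; have [<-|/yj] := eqVneq i j; first exact: hi.
  by rewrite ltnNge hi.
apply/dominantP => z; have [zM|] := boolP (z \in strictly_above j).
  exists j => x; rewrite !inE => /predU1P[->|Yx]; first exact: ymax.
  exact: leq_trans (ymax z zM) (jy x Yx).
rewrite inE negb_forall => /existsP[i]; rewrite negb_imply -leqNgt => /andP[ij zi].
exists i => x; rewrite !inE => /predU1P[->|Yx].
  exact: leq_trans zi (ltnW (yj i ij)).
exact: leq_trans zi (mn_min i x Yx).
Qed.

Definition top_above j :=
  [set y in strictly_above j | [forall z in strictly_above j, key j z <= key j y]].

Lemma card_top_above j : #|top_above j| = (strictly_above j != finset.set0).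
Proof.
rewrite /top_above; have [->|/finset.set0Pn[y0 y0j]] := eqVneq (strictly_above j) finset.set0.
  by apply/eqP; rewrite cards_eq0; apply/eqP/setP => y; rewrite finset.in_set finset.in_set0.
pose y := [arg max_(y > y0 in strictly_above j) key j y].
rewrite -/(top_above j); suff -> : top_above j = [set y] by rewrite cards1.
rewrite /y; case: arg_maxnP => // {}y yj ymax; apply/setP => z.
rewrite finset.in_set finset.in_set1; apply/andP/eqP => [[zj /forall_inP zmax]|->].
  apply: (key_inj j); apply/eqP; rewrite eqn_leq; apply/andP; split; [exact: ymax|exact: zmax].
by split => //; apply/forall_inP => w wj; exact: ymax.
Qed.

Lemma card_extensions i1 i2 : i1 != i2 -> mn i1 = mn i2 ->
  #|extensions Y| = (strictly_above i1 != finset.set0) + (strictly_above i2 != finset.set0).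
Proof.
move=> ne e; rewrite -!card_top_above.
have -> : extensions Y = top_above i1 :|: top_above i2.
  apply/setP => y; rewrite finset.in_setU; apply/idP/orP => [yE|].
    have [j + [yj ymax]] := extensions_sub i1 i2 y ne e yE.
    have yt : y \in top_above j.
      by rewrite finset.in_set; apply/andP; split => //; apply/forall_inP => z; exact: ymax.
    by rewrite finset.in_set2 => /orP[] /eqP jE; [left|right]; rewrite -jE.
  rewrite eq_sym in ne; move=> [] yt; move: (yt);
    rewrite finset.in_set => /andP[yj /forall_inP ymax].
    exact: (extensions_sup i2 i1).
  by rewrite eq_sym in ne; exact: (extensions_sup i1 i2).
rewrite cardsU (_ : _ :&: _ = finset.set0) ?cards0 ?subn0//.
apply/setP => y; rewrite !finset.in_setI finset.in_set0; apply/negP => /andP[].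
rewrite finset.in_set => /andP[/strictly_aboveP y1 _].
rewrite finset.in_set => /andP[/strictly_aboveP y2 _].
have /dominantP /(_ y)[i hi] := Ydom.
have : key i (mn i) < key i y.
  by have [->|/y1//] := eqVneq i i1; apply: y2.
by rewrite ltnNge hi.
Qed.

End Extensions.

(** The slack elements are the corners of the simplex: [slack i] is lowest in order [i] and above
    all ordinary points in the other orders. *)
Context (slack : I -> T) (col : T -> I) (col_slack : forall i, col (slack i) = i)
  (slack_low : forall i t, t != slack i -> key i (slack i) < key i t)
  (slack_high : forall i j t, i != j -> (forall k, t != slack k) ->
    key i t < key i (slack j))
  (exists_nonslack : exists t, forall k, t != slack k)
  (card_I : 1 < #|I|).

Lemma slack_inj : injective slack.
Proof. exact: can_inj col_slack. Qed.

Definition door i0 Y := [&& dominant Y, #|I| == #|Y|.+1 & col @: Y == [set~ i0]].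

(** A door with an ordinary point extends on both sides, since [slack j] is strictly above for
    either index; the door made of slacks alone lies on the boundary and extends on one side
    only. *)
Lemma odd_extensions i0 Y : door i0 Y ->
  odd #|extensions Y| = (Y == slack @: [set~ i0]).
Proof.
move=> /and3P[dY /eqP cY /eqP colY].
have /card_gt0P[y0 Yy0] : 0 < #|Y| by rewrite -ltnS -cY.
pose mn i := [arg min_(y < y0 in Y) key i y].
have mnY i : mn i \in Y by rewrite /mn; case: arg_minnP.
have mn_min i y : y \in Y -> key i (mn i) <= key i y.
  by rewrite /mn; case: arg_minnP => // z _ + Yy => /(_ y Yy).
have [i1 [i2 [ne e]]] := mn_collision dY cY mnY mn_min.
rewrite (card_extensions dY cY mnY mn_min i1 i2 ne e).
have [YE|YE] := eqVneq Y (slack @: [set~ i0]); last first.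
  have [t Yt tns] : exists2 t, t \in Y & forall k, t != slack k.
    apply: contrapT => h; move/eqP: YE; apply.
    apply/eqP; rewrite eqEcard; apply/andP; split; last first.
      by rewrite card_imset ?cardsC1 ?cY//; exact: slack_inj.
    apply/subsetP => t Yt; have [k /eqP tk] : exists k, t == slack k.
      apply: contrapT => h'; apply: h; exists t => // k.
      by apply/negP => tk; apply: h'; exists k.
    rewrite tk imset_f//; have : col t \in col @: Y by rewrite imset_f.
    by rewrite colY tk col_slack.
  have Mj j : strictly_above (mn := mn) j != finset.set0.
    apply/finset.set0Pn; exists (slack j); apply/strictly_aboveP => i ij.
    have [si|si] := boolP (slack i \in Y).
      apply: leq_ltn_trans (mn_min i _ si) (slack_low _ _ _).
      by rewrite (inj_eq slack_inj) eq_sym.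
    exact: leq_ltn_trans (mn_min i _ Yt) (slack_high _ _ _ ij tns).
  by rewrite !Mj.
have inY i : i != i0 -> slack i \in Y by move=> ii0; rewrite YE imset_f// !inE.
have mnE i : i != i0 -> mn i = slack i.
  move=> ii0; apply/eqP/negPn/negP => /slack_low.
  by rewrite ltnNge mn_min// inY.
(* Above [slack j] in order [i0] there are only other slacks, and such a [slack k] is not strictly
   above itself in order [k]; on the side of [i0] any ordinary point qualifies. *)
have half j : j != i0 -> mn i0 = mn j ->
    (strictly_above (mn := mn) i0 != finset.set0) /\ (strictly_above (mn := mn) j == finset.set0).
  move=> ji0 ej; split.
    have [t tns] := exists_nonslack.
    apply/finset.set0Pn; exists t; apply/strictly_aboveP => i ii0.
    by rewrite mnE//; exact: slack_low.
  apply/eqP/setP => y; rewrite finset.in_set0; apply/negP => /strictly_aboveP yj.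
  have := yj i0; rewrite eq_sym ji0 ej mnE// => /(_ isT) h.
  have [k /eqP yk] : exists k, y == slack k.
    apply: contrapT => nk; have : key i0 y < key i0 (slack j).
      apply: slack_high; first by rewrite eq_sym.
      by move=> k; apply/negP => yk; apply: nk; exists k.
    by rewrite ltnNge (ltnW h).
  have [kj|kj] := eqVneq k j; first by rewrite yk kj ltnn in h.
  have [ki0|ki0] := eqVneq k i0.
    move: h; rewrite yk ki0 ltnNge; apply/negP/negPn; apply: ltnW.
    by apply: slack_low; rewrite (inj_eq slack_inj).
  by have := yj k kj; rewrite mnE// yk ltnn.
have [i10|i10] := eqVneq i1 i0.
  rewrite i10 in ne e *; rewrite eq_sym in ne.
  by have [-> /eqP ->] := half i2 ne e; rewrite eqxx.
have [i20|i20] := eqVneq i2 i0.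
  rewrite i20 in ne e *.
  by have [-> /eqP ->] := half i1 ne (esym e); rewrite eqxx.
by move: e; rewrite !mnE// => /slack_inj /eqP; rewrite (negbTE ne).
Qed.

Definition doors_of i0 X := [set x in X | col @: (X :\ x) == [set~ i0]].

(** If a color is missing and some [X :\ x] is a door, the color of [x] occurs exactly once more, at
    [x']; removing [x] or [x'] gives the only two doors. *)
Lemma odd_doors_of i0 X : #|X| = #|I| -> odd #|doors_of i0 X| -> col @: X = [set: I].
Proof.
move=> cX; apply: contraTeq => ncol.
have [->|/finset.set0Pn[x]] := eqVneq (doors_of i0 X) finset.set0; first by rewrite cards0.
rewrite inE => /andP[Xx /eqP colx].
have cXx : #|I| = #|X :\ x|.+1 by rewrite -cX (cardsD1 x) Xx.
have injx : {in X :\ x &, injective col}.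
  by apply/imset_injP; rewrite colx cardsC1 cXx.
have xi0 : col x != i0.
  apply: contraNneq ncol => xi0; rewrite -(finset.setD1K Xx) imsetU1 colx xi0.
  by apply/eqP/setP => i; rewrite !inE orbN.
have : col x \in col @: (X :\ x) by rewrite colx !inE.
move=> /imsetP[x']; rewrite !inE => /andP[x'x Xx'] cx.
suff -> : doors_of i0 X = [set x; x'] by rewrite cards2 eq_sym x'x.
apply/setP => z; rewrite finset.in_set finset.in_set2; apply/andP/orP => [[Xz /eqP colz]|].
  have [|zx] := eqVneq z x; first by left.
  have [|zx'] := eqVneq z x'; first by right.
  have : col z \in col @: (X :\ x) by rewrite imset_f// !inE zx.
  rewrite colx -colz => /imsetP[w]; rewrite !inE => /andP[wz Xw] zw.
  have [wx|wx] := eqVneq w x.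
    have := injx z x'; rewrite !inE zx Xz x'x Xx' => /(_ isT isT).
    by rewrite zw wx cx => /(_ erefl) zE; rewrite zE eqxx in zx'.
  have := injx z w; rewrite !inE zx Xz wx Xw => /(_ isT isT zw) zE.
  by rewrite zE eqxx in wz.
move=> [] /eqP ->; split => //; first by apply/eqP.
rewrite -colx; apply/eqP/setP => i; apply/imsetP/imsetP => -[w].
  rewrite !inE => /andP[wx' Xw] ->; have [->|wx] := eqVneq w x.
    by exists x' => //; rewrite !inE x'x.
  by exists w => //; rewrite !inE wx.
rewrite !inE => /andP[wx Xw] ->; have [->|wx'] := eqVneq w x'.
  by exists x => //; rewrite !inE eq_sym x'x.
by exists w => //; rewrite !inE wx'.
Qed.

(* Scarf's lemma, by counting the pairs (facet, extension) in two ways. *)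
Lemma scarf : exists X, [/\ dominant X, #|X| = #|I| & col @: X = [set: I]].
Proof.
have [i0 _] : exists i0 : I, true by have /card_gt0P[i _] := ltnW card_I; exists i.
pose Y0 := slack @: [set~ i0].
have dY0 : door i0 Y0.
  apply/and3P; split.
  - apply/dominantP => y; have [[k /andP[ki0 /eqP ->]]|ny] :=
      pselect (exists k, (k != i0) && (y == slack k)).
      exists k => x _; have [->//|xk] := eqVneq x (slack k).
      exact: ltnW (slack_low _ _ xk).
    exists i0 => x /imsetP[k]; rewrite !inE => ki0 ->.
    have [->|yi0] := eqVneq y (slack i0).
      by apply: ltnW; apply: slack_low; rewrite (inj_eq slack_inj).
    apply: ltnW; apply: slack_high; first by rewrite eq_sym.
    move=> l; apply/negP => yl; apply: ny; exists l; rewrite yl andbT.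
    by apply: contraNneq yi0 => li0; rewrite -li0.
  - rewrite card_imset ?cardsC1; last exact: slack_inj.
    by rewrite prednK// ltnW.
  - rewrite -imset_comp; apply/eqP; rewrite -[RHS]imset_id.
    by apply: eq_imset => i /=.
have counts : \sum_(X | dominant X && (#|X| == #|I|)) #|doors_of i0 X| =
    \sum_(Y | door i0 Y) #|extensions Y|.
  under eq_bigr do rewrite -sum1_card.
  under [RHS]eq_bigr do rewrite -sum1_card.
  rewrite !pair_big_dep /=.
  rewrite (reindex_onto (fun p => (p.2 |: p.1, p.2)) (fun p => (p.1 :\ p.2, p.2))) /=.
    apply: eq_bigl => -[Y y] /=; rewrite !inE eqxx /= /door xpair_eqE eqxx andbT.
    have [Yy|Yy] := boolP (y \in Y).
      rewrite !andbF; apply/negbTE; rewrite negb_and; apply/orP; right.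
      by apply/eqP => YE; move: Yy; rewrite -YE !inE eqxx.
    rewrite finset.setU1K// eqxx andbT cardsU1 Yy add1n [#|I| == _]eq_sym.
    have [dX|] := boolP (dominant (y |: Y)); last by rewrite /= !andbF.
    by rewrite (dominantS _ _ (finset.subsetUr _ _) dX) /= andbT.
  by move=> [X x] /= /andP[_]; rewrite inE => /andP[Xx _]; rewrite finset.setD1K.
apply: contrapT => nX.
have oddl : ~~ odd (\sum_(X | dominant X && (#|X| == #|I|)) #|doors_of i0 X|).
  elim/big_ind: _ => // [a b oa ob|X /andP[dX /eqP cX]].
    by rewrite oddD (negbTE oa) (negbTE ob).
  by apply/negP => /(odd_doors_of _ _ cX) h; apply: nX; exists X.
move: oddl; rewrite counts (bigD1 Y0)//= oddD (odd_extensions i0 Y0 dY0) eqxx /=.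
rewrite negbK; apply/negP.
elim/big_ind: _ => // [a b oa ob|Y /andP[dY YY0]].
  by rewrite oddD (negbTE oa) (negbTE ob).
by rewrite (odd_extensions i0 Y dY) -/Y0 (negbTE YY0).
Qed.

End Scarf.

(** * Scarf's lemma on a simplex grid *)

Section Grid.
Import fintype finset.
Local Open Scope nat_scope.
Local Open Scope set_scope.
Context {I : finType} (N : nat).

Definition grid := {x : {ffun I -> 'I_N.+1} | \sum_i (x i : nat) == N}.

HB.instance Definition _ := Finite.on grid.

Let card_grid : nat := #|{: grid}|.

Let rank (x : grid) : nat := enum_rank x.

Let rank_lt x : rank x < card_grid. Proof. exact: ltn_ord. Qed.

Let rank_inj : injective rank.
Proof. by move=> x y /val_inj /enum_rank_inj. Qed.

(** Coordinate [i] comes first and the rank breaks ties, which makes the key injective; the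
    successor reserves 0 for the slack of [i]. *)
Definition grid_key (i : I) (t : (grid + I)%type) : nat :=
  match t with
  | inl x => (sval x i * card_grid + rank x).+1
  | inr j => if j == i then 0 else (N.+1 * card_grid + enum_rank j).+1
  end.

Lemma grid_key_le (i : I) (x y : grid) :
  grid_key i (inl x) <= grid_key i (inl y) -> sval x i <= sval y i.
Proof.
have ry := rank_lt y.
rewrite /= ltnS; move: (sval x i : nat) (sval y i : nat) (rank x) => a b r h.
rewrite leqNgt; apply/negP => ab; have := leq_mul ab (leqnn card_grid).
by rewrite mulSn; lia.
Qed.

Lemma grid_key_bound (i : I) (x : grid) :
  grid_key i (inl x) <= N.+1 * card_grid.
Proof.
have rx := rank_lt x.
have xN : sval x i <= N by rewrite -ltnS.
have := leq_mul xN (leqnn card_grid).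
by move: rx; rewrite /= mulSn; lia.
Qed.

Lemma grid_key_inj (i : I) : injective (grid_key i).
Proof.
move=> [x|j] [y|k] e.
- have xy : (sval x i : nat) = sval y i.
    by apply/eqP; rewrite eqn_leq !grid_key_le// e.
  by move: e => /= [] /eqP; rewrite xy eqn_add2l => /eqP /rank_inj ->.
- have := grid_key_bound i x; rewrite e /=; case: eqP => [ki|_]; last by lia.
  by move: e => /=; rewrite ki eqxx.
- have := grid_key_bound i y; rewrite -e /=; case: eqP => [ki|_]; last by lia.
  by move: e => /=; rewrite ki eqxx.
- move: e => /=; case: eqP => [->|_]; case: eqP => [->|_] //.
  by move=> [] /eqP; rewrite eqn_add2l => /eqP /val_inj /enum_rank_inj ->.
Qed.

Lemma grid_inhabited (f : I -> nat) (i1 : I) : \sum_i f i <= N ->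
  exists x : grid, forall i, f i <= sval x i.
Proof.
move=> fN; pose g i := f i + (if i == i1 then N - \sum_i f i else 0).
have gN : \sum_i g i = N.
  by rewrite big_split/= -big_mkcond big_pred1_eq subnKC.
have gi i : g i < N.+1 by rewrite ltnS -[X in _ <= X]gN (bigD1 i)//= leq_addr.
have xN : \sum_i ([ffun i => Ordinal (gi i)] i : nat) == N.
  by rewrite -[X in _ == X]gN; apply/eqP; apply: eq_bigr => i _; rewrite ffunE.
exists (exist (fun x : {ffun I -> 'I_N.+1} => is_true (\sum_i (x i : nat) == N))
  [ffun i => Ordinal (gi i)] xN) => i /=; rewrite ffunE /= /g; exact: leq_addr.
Qed.

(** A color whose slack is absent from the dominating set must come from one of its grid points.
    Dominance forces all these grid points close together, with small coordinates at the slacks that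
    are present. *)
Lemma scarf_grid (c : grid -> I) : 1 < #|I| ->
  exists x : grid, forall i, sval x i <= #|I| \/
    exists x' : grid, c x' = i /\
      forall j, sval x j <= sval x' j + #|I| /\ sval x' j <= sval x j + #|I|.
Proof.
move=> cI; have /card_gt0P[i0 _] := ltnW cI.
pose col (t : (grid + I)%type) : I := match t with inl x => c x | inr j => j end.
have [g0 _] : exists x : grid, forall i, 0 <= sval x i.
  by apply: (grid_inhabited (fun=> 0) i0); rewrite big1.
have [X [/dominantP Xdom _ Xcol]] : exists X : {set (grid + I)%type},
    [/\ dominant grid_key X, #|X| = #|I| & col @: X = [set: I]].
  apply: (scarf grid_key grid_key_inj inr col) => //.
  - move=> i [x|j] /= ti; first by rewrite eqxx.
    rewrite eqxx; case: eqP => // ji; by rewrite ji eqxx in ti.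
  - move=> i j [x|k] ij tns; last by have := tns k; rewrite eqxx.
    apply: leq_ltn_trans (grid_key_bound i x) _.
    by rewrite /= eq_sym (negbTE ij) ltnS leq_addr.
  - by exists (inl g0).
pose sg := [set x : grid | inl x \in X].
have colC i : inr i \notin X -> exists2 x, x \in sg & c x = i.
  move=> iX; have : i \in col @: X by rewrite Xcol inE.
  move=> /imsetP[[x|j] tX /= iE]; first by exists x; rewrite ?inE.
  by rewrite iE tX in iX.
have domC (y : grid) : exists2 i, inr i \notin X &
    forall x, x \in sg -> sval y i <= sval x i.
  have [i hi] := Xdom (inl y); exists i.
    by apply/negP => /hi /=; rewrite eqxx.
  by move=> x; rewrite inE => /hi /grid_key_le.
have [x0 sx0] : exists x0, x0 \in sg.
  by have [i /colC[x sx _] _] := domC g0; exists x.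
pose m i := val [arg min_(x < x0 in sg) sval x i] i : nat.
have mle i x : x \in sg -> m i <= sval x i.
  by rewrite /m; case: arg_minnP => // y _ + sx => /(_ x sx).
have mE i : exists2 x, x \in sg & m i = sval x i.
  by rewrite /m; case: arg_minnP => // y sy _; exists y.
pose C := [pred i | inr i \notin X].
(* Otherwise some grid point would exceed every minimum [m i] with [i] in [C], against dominance. *)
have mN : N < \sum_(i in C) (m i + 1).
  rewrite ltnNge; apply/negP => mN.
  have [|y yP] := grid_inhabited (fun i => if i \in C then m i + 1 else 0) i0.
    by rewrite -big_mkcond.
  have [i iX yi] := domC y; have [x sx mx] := mE i.
  have := yi x sx; rewrite -mx; have := yP i; rewrite inE iX; lia.
have {}mN : N < \sum_(i in C) m i + #|I|.
  apply: leq_trans mN _; rewrite big_split/= sum1_card leq_add2l.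
  exact: max_card.
have sumx (x : grid) : \sum_i (sval x i : nat) = N by apply/eqP; exact: (svalP x).
(* The coordinates of [x] sum to [N], and the minima over [C] already use up more than [N - #|I|],
   so little is left above any of them. *)
have inC x j : x \in sg -> j \in C -> sval x j <= m j + #|I|.
  move=> sx Cj; have := sumx x; move: mN.
  rewrite (bigD1 j)//= [X in _ -> X = _ -> _](bigD1 j)//=.
  have : \sum_(i in C | i != j) m i <= \sum_(i | i != j) sval x i.
    rewrite big_mkcondl; apply: leq_sum => i _; case: ifP => // _; exact: mle.
  lia.
have notC x j : x \in sg -> j \notin C -> sval x j <= #|I|.
  move=> sx Cj; have := sumx x; move: mN.
  rewrite [X in _ -> X = _ -> _](bigD1 j)//=.
  have : \sum_(i in C) m i <= \sum_(i | i != j) sval x i.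
    rewrite big_mkcond [leqRHS]big_mkcond; apply: leq_sum => i _.
    case: ifP => // Ci; case: eqP => [ij|_]; last exact: mle.
    by rewrite -ij Ci in Cj.
  lia.
exists x0 => i; have [iX|iX] := boolP (inr i \in X).
  by left; apply: notC; rewrite // inE negbK.
right; have [x sx cx] := colC i iX; exists x; split => // j.
have [jC|jC] := boolP (j \in C).
  have := inC x j sx jC; have := inC x0 j sx0 jC.
  by have := mle j x sx; have := mle j x0 sx0; lia.
by have := notC x j sx jC; have := notC x0 j sx0 jC; lia.
Qed.

End Grid.

(** * Fixed points *)

Section ApproximateFixedPoint.
Context {R : realType} {E : normedModType R}.

(* In the grid point given by Scarf's lemma, the indices i with no nearby point
   of color i carry a total weight of at most #|I| ^ 2 / N; as f x is the weighted
   mean of the f (b i), some other index i satisfies f x - e <= f (b i). *)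
Lemma scarf_convex (I : finType) (b : I -> E) (M e : R) (C : set E)
    (P : I -> E -> Prop) :
  (1 < #|I|)%N -> 0 < e -> (forall i, `|b i| <= M) ->
  (forall t : I -> R, (forall i, 0 <= t i) -> \sum_i t i = 1 ->
    C (\sum_i t i *: b i)) ->
  (forall x, C x -> exists i, P i x) ->
  exists2 x, C x & forall f, dual_ball 1 f ->
    exists i x', [/\ P i x', `|x - x'| <= e & f x - e <= f (b i)].
Proof.
move=> cI e0 bM bC CP.
have [i0 _] : exists i0 : I, true by have /card_gt0P[i _] := ltnW cI; exists i.
have M0 : 0 <= M := le_trans (normr_ge0 _) (bM i0).
pose n : R := #|I|%:R.
have n0 : 0 < n by rewrite ltr0n ltnW.
(* Fine enough both for the distance between nearby grid points, at most [n * n * M / N], and for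
   the total error of the mean of the [f (b i)]. *)
pose N := (Num.truncn (n * n * (2 * M + e) / e)).+1.
have N0 : 0 < (N%:R : R) by rewrite ltr0n.
have Ne : n * n * (2 * M + e) < N%:R * e.
  by rewrite -ltr_pdivrMr//; exact: truncnS_gt.
pose w (x : @grid I N) (i : I) : R := (sval x i)%:R / N%:R.
have w0 x i : 0 <= w x i by rewrite divr_ge0// ?ler0n// ltW.
have w1 x : \sum_i w x i = 1.
  by rewrite -mulr_suml -natr_sum (eqP (svalP x)) mulfV// gt_eqF.
pose p x := \sum_i w x i *: b i.
have Cp x : C (p x) by exact: bC.
have /choice[c cP] : forall x, exists i, P i (p x) by move=> x; exact: CP.
have [x xP] := @scarf_grid I N c cI; exists (p x) => // f f1.
have fp : f (p x) = \sum_i w x i * f (b i).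
  rewrite /p; elim/big_rec2: _ => [|i y z _ <-]; first exact: dual_ball0 f1.
  by rewrite f1.1.
have fb i : `|f (b i)| <= M.
  by apply: le_trans (f1.2 _) _; rewrite mul1r.
have fpM : `|f (p x)| <= M.
  rewrite fp; apply: le_trans (ler_norm_sum _ _ _) _.
  rewrite -[M]mul1r -(w1 x) mulr_suml; apply: ler_sum => i _.
  by rewrite normrM ger0_norm// ler_wpM2l.
have nN : n / N%:R * n * (2 * M + e) < e.
  have -> : n / N%:R * n * (2 * M + e) = n * n * (2 * M + e) / N%:R.
    by move: (N%:R : R) N0 => r r0; field; rewrite gt_eqF.
  by rewrite ltr_pdivrMr// [X in _ < X]mulrC.
have [i [ix ie]] : exists i, (#|I| < sval x i)%N /\ f (p x) - e <= f (b i).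
  apply: contrapT => h.
  have small i : w x i * (f (b i) - f (p x)) <=
      - e * w x i + n / N%:R * (2 * M + e).
    have [ix|ix] := ltnP #|I| (sval x i).
      have fi : f (b i) < f (p x) - e.
        by rewrite ltNge; apply/negP => fi; apply: h; exists i.
      apply: (@le_trans _ _ (- e * w x i)).
        by rewrite [- e * _]mulrC ler_wpM2l//; move: fi; lra.
      by rewrite lerDl mulr_ge0// ?divr_ge0 ?(ltW n0) ?(ltW N0)//; lra.
    have : w x i <= n / N%:R by rewrite ler_pM2r ?invr_gt0// ler_nat.
    move=> wn; have : w x i * (f (b i) - f (p x) + e) <= w x i * (2 * M + e).
      rewrite ler_wpM2l//; have := fb i; move: fpM; rewrite !ler_norml.
      by move=> /andP[? ?] /andP[? ?]; lra.
    have : w x i * (2 * M + e) <= n / N%:R * (2 * M + e) by rewrite ler_wpM2r//; lra.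
    lra.
  have : \sum_i w x i * (f (b i) - f (p x)) = 0.
    under eq_bigr do rewrite mulrBr.
    by rewrite sumrB -fp -mulr_suml w1 mul1r subrr.
  apply/eqP; rewrite lt_eqF//; apply: (@le_lt_trans _ _ (- e + n / N%:R * n * (2 * M + e))).
    apply: le_trans (ler_sum _ (fun i _ => small i)) _.
    rewrite big_split/= -mulr_sumr w1 mulr1 sumr_const.
    by rewrite lerD2l (mulrAC _ n) [X in _ <= X]mulr_natr.
  by lra.
have [|[x' [cx' xx']]] := xP i; first by rewrite leqNgt ix.
exists i, (p x'); split => //; first by rewrite -cx'; exact: cP.
rewrite /p -sumrB; apply: le_trans (ler_norm_sum _ _ _) _.
apply: (@le_trans _ _ (\sum_(j : I) n / N%:R * M)).
  apply: ler_sum => j _; rewrite -scalerBl normrZ ler_pM//.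
  rewrite /w -mulrBl normrM [X in _ * X]ger0_norm ?invr_ge0 ?(ltW N0)//.
  rewrite ler_pM2r ?invr_gt0//; have [h1 h2] := xx' j.
  by rewrite ler_norml; move: h1 h2; rewrite -!(ler_nat R) !natrD -/n; lra.
rewrite sumr_const -[_ *+ _]mulr_natr -/n mulrAC; apply: ltW; apply: le_lt_trans nN.
by rewrite ler_wpM2l ?mulr_ge0 ?divr_ge0 ?(ltW n0) ?(ltW N0)//; lra.
Qed.

End ApproximateFixedPoint.

Section FixedPoint.
Context {R : realType}.

(** The values of the first functionals are sorted into cells of width e/2, and each nonempty cell
    gets a representative in [W]; passing to the closure costs the other e/2. *)
Lemma finite_weak_net {E : normedModType R} (g : nat -> E -> R) (W : set E)
    (M e : R) (k : nat) : (forall n, dual_ball 1 (g n)) -> W !=set0 ->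
  (forall w, W w -> `|w| <= M) -> 0 < e ->
  exists (I : finType) (a : I -> E), [/\ (1 < #|I|)%N, forall i, W (a i) &
    forall y, closure W y -> exists i, forall n, (n <= k)%N ->
      `|g n (a i) - g n y| <= e].
Proof.
move=> g1 [w0 Ww0] WM e0; have e20 : 0 < e / 2 by rewrite divr_gt0.
pose q n y : R := (g n y + M) / (e / 2).
pose m := Num.truncn ((M + M) / (e / 2)).
(* The cells 0 to [m] suffice for the values; the extra one ensures the two indices that Scarf's
   lemma asks for. *)
pose I : finType := {ffun 'I_k.+1 -> 'I_m.+2}.
have qW n w : W w -> 0 <= q n w /\ (Num.truncn (q n w) < m.+2)%N.
  move=> Ww; have : `|g n w| <= M.
    by apply: le_trans ((g1 n).2 w) _; rewrite mul1r; exact: WM.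
  rewrite ler_norml => /andP[h1 h2].
  have q0 : 0 <= q n w by rewrite divr_ge0 ?(ltW e20)//; lra.
  split => //; rewrite ltnS leqW//; apply: le_truncn.
  by rewrite ler_wpM2r ?invr_ge0 ?(ltW e20)// lerD2r.
pose code w : I := [ffun n : 'I_k.+1 => inord (Num.truncn (q n w))].
have codeW w w' n : W w -> W w' -> code w = code w' -> (n <= k)%N ->
    `|g n w - g n w'| <= e / 2.
  move=> Ww Ww' /ffunP /(_ (inord n)) + nk; rewrite !ffunE !inordK// => /(congr1 (@nat_of_ord _)).
  have [qw lw] := qW n w Ww; have [qw' lw'] := qW n w' Ww'.
  rewrite !inordK// => qq.
  have := truncn_itv qw; have := truncn_itv qw'; rewrite qq.
  have -> : g n w = q n w * (e / 2) - M by rewrite /q divfK ?gt_eqF//; lra.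
  have -> : g n w' = q n w' * (e / 2) - M by rewrite /q divfK ?gt_eqF//; lra.
  move: (q n w) (q n w') (Num.truncn _) => a b r /andP[h1 h2] /andP[h3 h4].
  rewrite -natr1 in h2 h4.
  rewrite (_ : _ - _ = (a - b) * (e / 2)); last by ring.
  rewrite normrM (gtr0_norm e20).
  by rewrite ger_pMl// ler_norml; lra.
have /choice[a aP] : forall i : I, exists w, W w /\
    ((exists2 w', W w' & code w' = i) -> code w = i).
  move=> i; have [[w' Ww' wi]|h] := pselect (exists2 w', W w' & code w' = i).
    by exists w'.
  by exists w0; split => // /h.
exists I, a; split => [|i|y Wy].
- rewrite card_ffun !card_ord expnS.
  by apply: leq_trans (leq_pmulr _ _); rewrite // expn_gt0.
- exact: (aP i).1.
have [w [Ww]] := Wy _ (nbhsx_ballx y _ e20); rewrite -ball_normE /= => yw.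
exists (code w) => n nk.
have [Wa ca] := aP (code w).
have := codeW _ _ n Wa Ww (ca (ex_intro2 _ _ w Ww erefl)) nk.
have : `|g n w - g n y| <= `|y - w|.
  rewrite -(dual_ballB _ _ _ _ (g1 n)) distrC.
  by apply: le_trans ((g1 n).2 _) _; rewrite mul1r.
have := ler_distD (g n w) (g n (a (code w))) (g n y); lra.
Qed.

Lemma increasing_seq_comp (phi psi : nat -> nat) :
  increasing_seq phi -> increasing_seq psi -> increasing_seq (phi \o psi).
Proof. by move=> iphi ipsi m n; rewrite /= iphi -leEnat ipsi. Qed.

Lemma weak_cvg_increasing {E : normedModType R} (phi : nat -> nat) (u : nat -> E) x :
  increasing_seq phi -> weak_cvg_to u x -> weak_cvg_to (u \o phi) x.
Proof.
move=> iphi /weak_cvg_seqP ux; apply/weak_cvg_seqP => f f1.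
exact: (cvg_increasing phi (f \o u) (f x) iphi (ux f f1)).
Qed.

Lemma cvg_close_unique (s s' : nat -> R) (l l' : R) :
  s n @[n --> \oo] --> l -> s' n @[n --> \oo] --> l' ->
  (forall k, `|s k - s' k| <= k.+1%:R^-1 + k.+1%:R^-1) -> l = l'.
Proof.
move=> sl sl' ss'; apply/eqP; rewrite -subr_eq0 -normr_le0.
rewrite -[leRHS]addr0.
exact: (ler_cvg_to (cvg_norm (cvgB sl sl')) (cvgD cvg_inv_succ cvg_inv_succ) (nearW _ ss')).
Qed.

(** * The damped equation *)

Section Damped.
Context {E : completeNormedModType R} (S : set E) (T : E -> set E) (Omega : set E).
Context (T_graph : weakly_seq_closed_graph S T)
  (OmegaS : Omega `<=` S) (T_Omega : forall x, Omega x -> T x !=set0 /\ T x `<=` Omega)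
  (Omega_closed : closed Omega) (Omega_convex : convex_set Omega)
  (Omega_bounded : bounded_set Omega)
  (T_values : forall x, Omega x -> closed (T x) /\ convex_set (T x))
  (T_nonexp : countably_beta_nonexpansive Omega T).

Lemma damped_fixed_point (x0 : E) (c : R) : Omega x0 -> 0 < c < 1 ->
  exists x y, [/\ Omega x, T x y & x = c *: y + (1 - c) *: x0].
Proof.
move=> Ox0 c01; have /andP[c0 c1] := c01.
have /choice[b bP] : forall x, exists y, Omega x -> T x y.
  move=> x; have [/T_Omega[[y Txy] _]|nOx] := pselect (Omega x); first by exists y.
  by exists 0.
pose h w := c *: b w + (1 - c) *: x0.
have bE w : b w = c^-1 *: (h w - (1 - c) *: x0).
  by rewrite addrK scalerA mulVf ?scale1r// gt_eqF.
pose W : set E := orbit_hull x0 h.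
have /convex_setP cO := Omega_convex.
have WO : W `<=` Omega.
  move=> w; elim=> // [{}w _ Ow|q x y /andP[q0 q1] _ Ox _ Oy].
    by apply: cO; rewrite ?(ltW c0) ?(ltW c1)//; exact: (T_Omega _ Ow).2 _ (bP w Ow).
  apply: cO => //; rewrite ler0q q0 /=.
  by rewrite -(rmorph1 (@ratr R)) ler_rat.
have [M OM] := (bounded_setP Omega).1 Omega_bounded.
have [u Wu] : exists u : nat -> E, W = range u := orbit_hull_enum x0 h.
have bW : bounded_set W by apply/bounded_setP; exists M => w /WO /OM.
have cW : countable W by rewrite Wu; exact: card_image_le.
have cC : weakly_compact (closure W).
  apply: (orbit_hull_weakly_compact x0 c b (mimage T W)) => //.
  - exact: T_nonexp.1.
  - by move=> w Ww; exists w => //; exact: bP (WO w Ww).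
  - exact: T_nonexp.2.
pose C := closure W.
have CO : C `<=` Omega.
  exact: subset_trans (closureS WO) Omega_closed.
have WC : W `<=` C := @subset_closure _ W.
have convC : convex_set C := closure_orbit_hull_convex x0 h.
have Wh w : W w -> W (h w) by exact: orbit_hull_map.
have [g g1 gsep] := separating_functionals u.
have CF : C `<=` closure (rat_span u).
  by apply: closureS; rewrite Wu => _ [n _ <-]; exact: (rat_span_gen u n).
(* One 1/(k+1) comes from the net, the other from the distance between nearby grid points; [x] is
   fixed before [f], and only [a] depends on [f]. *)
have /choice[x xP] : forall k, exists x, C x /\ forall f, dual_ball 1 f ->
    exists a, [/\ W a, forall n, (n <= k)%N ->
      `|g n a - g n x| <= k.+1%:R^-1 + k.+1%:R^-1 & f x - k.+1%:R^-1 <= f (h a)].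
  move=> k; have k0 : 0 < (k.+1%:R : R)^-1 by rewrite invr_gt0 ltr0n.
  have [I [a [cI Wa aP]]] := finite_weak_net g W M _ k g1
    (ex_intro _ x0 (orbit_hull_base x0 h)) (fun w Ww => OM w (WO w Ww)) k0.
  have [x Cx xP] := scarf_convex I (h \o a) M _ C
    (fun i y => forall n, (n <= k)%N -> `|g n (a i) - g n y| <= k.+1%:R^-1) cI k0
    (fun i => OM _ (WO _ (Wh _ (Wa i))))
    (fun t => convex_sum C I (h \o a) t convC (fun i => WC _ (Wh _ (Wa i)))) aP.
  exists x; split => // f f1; have [i [x' [ix' xx' fi]]] := xP f f1.
  exists (a i); split => // n nk.
  apply: le_trans (ler_distD (g n x') _ _) _; apply: lerD; first exact: ix'.
  rewrite -(dual_ballB _ _ _ _ (g1 n)); apply: le_trans ((g1 n).2 _) _.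
  by rewrite mul1r distrC.
have [phi iphi [z Cz xz]] := weakly_compact_sequential C x cC (fun k => (xP k).1).
have Oz := CO z Cz.
(* This is c T(z) + (1 - c) x0, written as a preimage so that closedness and convexity come from
   [T z]. *)
pose A := [set w | T z (c^-1 *: (w - (1 - c) *: x0))].
suff Az : A z.
  exists z, (c^-1 *: (z - (1 - c) *: x0)); split => //.
  by rewrite scalerA mulfV ?gt_eqF// scale1r subrK.
have [clT /convex_setP cT] := T_values z Oz.
have clA : closed A.
  apply: (@closed_comp _ _ (fun w : E => c^-1 *: (w - (1 - c) *: x0)) (T z)) => //.
  by move=> w _; apply: cvgZr; apply: cvgB; [exact: cvg_id|exact: cvg_cst].
have cA : convex_set A.
  apply/convex_setP => w w' t t01 Aw Aw'; rewrite /A /=.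
  have := cT _ _ t t01 Aw Aw'; congr (T z _).
  rewrite !scalerA [t * _]mulrC [(1 - t) * _]mulrC -!scalerA -scalerDr; congr (_ *: _).
  rewrite !scalerBr addrACA -opprD; congr (_ - _).
  by rewrite -scalerDl (_ : t + (1 - t) = 1) ?scale1r//; ring.
have A0 : A !=set0.
  exists (h z); rewrite /A /= -bE; exact: bP.
apply: contrapT => nAz.
have [f [d [f1 d0 fd]]] := convex_separation A z clA cA A0 nAz.
(* Separation puts [A] above [z] for [f]; the estimate at [x k] is therefore used with [- f], which
   gives f(h(a)) <= f(x k) + 1/(k+1). *)
have f'1 : dual_ball 1 (fun y => -1 * f y).
  by have := dual_ball_scale 1 (-1) f f1; rewrite normrN1 mulr1.
have /choice[a aP] := fun k => (xP k).2 _ f'1.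
have [psi ipsi [z' Cz' az']] := weakly_compact_sequential C (a \o phi) cC
  (fun k => WC _ (let: And3 Wa _ _ := aP (phi k) in Wa)).
have le_inv k : (((phi \o psi) k).+1%:R^-1 : R) <= k.+1%:R^-1.
  rewrite lef_pV2 ?posrE ?ltr0n// ler_nat ltnS.
  exact: increasing_seq_ge (increasing_seq_comp _ _ iphi ipsi).
have xz' := weak_cvg_increasing psi _ _ ipsi xz.
have z'z : z' = z.
  apply: gsep => [||n]; [exact: CF|exact: CF|].
  have := (weak_cvg_seqP _ _).1 az' _ (g1 n) => ga.
  have := (weak_cvg_seqP _ _).1 xz' _ (g1 n) => gx.
  (* The shift by [n] makes the index at least [n], so that [g n] is among the controlled
     functionals from the start. *)
  apply: (cvg_close_unique (fun k => g n (a (phi (psi (k + n)%N))))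
    (fun k => g n (x (phi (psi (k + n)%N))))) => [||k].
  - by move: ga; rewrite -(cvg_shiftn n).
  - by move: gx; rewrite -(cvg_shiftn n).
  have [_ + _] := aP (phi (psi (k + n)%N)) => /(_ n).
  have le1 := increasing_seq_ge _ (k + n)%N (increasing_seq_comp _ _ iphi ipsi).
  rewrite (leq_trans (leq_addl k n) le1) => /(_ isT) /le_trans; apply.
  have : ((phi (psi (k + n)%N)).+1%:R^-1 : R) <= k.+1%:R^-1.
    by rewrite lef_pV2 ?posrE ?ltr0n// ler_nat ltnS (leq_trans (leq_addr n k) le1).
  by move=> h1; exact: lerD.
rewrite {}z'z in az'.
have [th ith [w Cw hw]] := weakly_compact_sequential C (h \o a \o phi \o psi) cC
  (fun k => WC _ (Wh _ (let: And3 Wa _ _ := aP _ in Wa))).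
have aW k : W (a k) by have [] := aP k.
have Aw : A w.
  apply: (T_graph (fun k => a (phi (psi (th k)))) (fun k => b (a (phi (psi (th k)))))).
  - by move=> k; apply: OmegaS; exact: WO.
  - exact: OmegaS.
  - exact: (weak_cvg_increasing th _ _ ith az').
  - by move=> k; apply: bP; exact: WO.
  - apply/weak_cvg_seqP => f0 f01.
    have := (weak_cvg_seqP _ _).1 hw _ f01 => f0h.
    rewrite (dual_ballZ _ _ _ _ f01) (dual_ballB _ _ _ _ f01).
    have hl : c^-1 * (f0 (h (a (phi (psi (th k))))) - f0 ((1 - c) *: x0)) @[k --> \oo] -->
        c^-1 * (f0 w - f0 ((1 - c) *: x0)).
      exact: cvgM (cvg_cst (c^-1 : R)) (cvgB f0h (cvg_cst _)).
    have fbE : (fun k => c^-1 * (f0 (h (a (phi (psi (th k))))) - f0 ((1 - c) *: x0))) =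
        (fun k => f0 (b (a (phi (psi (th k)))))).
      apply/funext => k; rewrite [in RHS]bE [RHS](dual_ballZ _ _ _ _ f01).
      by rewrite (dual_ballB _ _ _ _ f01).
    by rewrite fbE in hl; exact: hl.
have := fd w Aw.
have fx : - f (x (phi (psi (th k)))) - k.+1%:R^-1 @[k --> \oo] --> - f z - 0.
  apply: cvgB; last exact: cvg_inv_succ.
  apply: cvgN; exact: (weak_cvg_seqP _ _).1 (weak_cvg_increasing th _ _ ith xz') _ f1.
have fh : - f (h (a (phi (psi (th k))))) @[k --> \oo] --> - f w.
  by apply: cvgN; exact: (weak_cvg_seqP _ _).1 hw _ f1.
have : - f z - 0 <= - f w.
  apply: (ler_cvg_to fx fh); apply: nearW => k.
  have [_ _] := aP (phi (psi (th k))); rewrite !mulN1r; apply: le_trans.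
  rewrite lerD2l lerN2 lef_pV2 ?posrE ?ltr0n// ler_nat ltnS.
  exact: increasing_seq_ge (increasing_seq_comp _ _ (increasing_seq_comp _ _ iphi ipsi) ith).
by move: d0; lra.
Qed.

End Damped.

End FixedPoint.

(** The hulls decrease and [T] sends each into the next, so each of them is invariant under [T]. *)
Lemma iter_hullP {R : realType} {E : normedModType R} (S : set E) (T : E -> set E) n :
  S !=set0 -> closed S -> convex_set S -> multimap_on S T ->
  [/\ closed (iter_hull S T n), convex_set (iter_hull S T n),
    iter_hull S T n !=set0, iter_hull S T n `<=` S
    & forall x, iter_hull S T n x -> T x `<=` iter_hull S T n].
Proof.
move=> S0 clS cS TS.
have TnS m x : iter_hull S T m x -> T x `<=` iter_hull S T m.+1.
  by move=> Sx y Txy A [_]; apply; exists x.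
have SnS m : iter_hull S T m.+1 `<=` iter_hull S T m.
  elim: m => [|m IHm].
    by apply: closed_convex_hull_sub => // y [x Sx]; exact: (TS x Sx).2.
  apply: closed_convex_hull_sub; [exact: closed_convex_hull_closed|
    exact: closed_convex_hull_convex|].
  by move=> y [x /IHm Sx]; exact: TnS.
have SS m : iter_hull S T m `<=` S by elim: m => // m; exact: subset_trans.
split => //.
- by case: n => // n; exact: closed_convex_hull_closed.
- by case: n => // n; exact: closed_convex_hull_convex.
- elim: n => // n [x Sx]; have [[y Txy] _] := TS x (SS n x Sx).
  by exists y; exact: TnS Txy.
- by move=> x Sx y Txy; apply: SnS; exact: TnS Txy.
Qed.

Theorem corollary3p1 (R : realType) (E : completeNormedModType R)
  (S : set E) (T : E -> set E) (Omega : set E)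
  (S_neq0 : S !=set0) (S_closed : closed S) (S_convex : convex_set S)
  (T_multimap : multimap_on S T)
  (T_graph : weakly_seq_closed_graph S T)
  (Omega_iter : exists n : nat, Omega = iter_hull S T n)
  (Omega_bounded : bounded_set Omega)
  (T_hemi : hemi_weakly_compact Omega T)
  (T_values : forall x, Omega x -> closed (T x) /\ convex_set (T x))
  (T_nonexp : countably_beta_nonexpansive Omega T) :
  exists x, Omega x /\ T x x.
Proof.
have [Oclosed Oconvex [x0 Ox0] OS TO] : [/\ closed Omega, convex_set Omega,
    Omega !=set0, Omega `<=` S & forall x, Omega x -> T x `<=` Omega].
  by have [n ->] := Omega_iter; exact: iter_hullP.
have T_Omega x : Omega x -> T x !=set0 /\ T x `<=` Omega.
  by move=> Ox; split; [exact: (T_multimap x (OS x Ox)).1|exact: TO].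
have [M OM] := (bounded_setP Omega).1 Omega_bounded.
(* The damping factor 1 - 1/(n+2) lies strictly between 0 and 1 already for n = 0. *)
have /choice[u /choice[v uvP]] : forall n : nat, exists x y, [/\ Omega x, T x y &
    x = (1 - n.+2%:R^-1) *: y + (1 - (1 - n.+2%:R^-1)) *: x0].
  move=> n; have n0 : 0 < (n.+2%:R : R)^-1 by rewrite invr_gt0 ltr0n.
  have n1 : (n.+2%:R : R)^-1 < 1 by rewrite invf_lt1 ?ltr0n// ltr1n.
  apply: (damped_fixed_point S T Omega) => //.
  by move: (n.+2%:R^-1 : R) n0 n1 => r r0 r1; apply/andP; split; lra.
have uv0 : weak_cvg_to (fun n => u n - v n) 0.
  apply/weak_cvg_seqP => f f1; rewrite (dual_ball0 _ _ f1).
  have M0 : 0 <= M := le_trans (normr_ge0 _) (OM x0 Ox0).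
  have hb : (M + M) * n.+1%:R^-1 @[n --> \oo] --> (M + M) * 0.
    exact: cvgM (cvg_cst (M + M)) (@cvg_inv_succ R).
  rewrite mulr0 in hb; apply/cvgrPdist_le => e e0.
  have /cvgrPdist_le/(_ e e0) := hb; apply: filterS => n.
  rewrite !sub0r !normrN; apply: le_trans; rewrite [leRHS]ger0_norm; last first.
    by rewrite mulr_ge0 ?addr_ge0// invr_ge0 ler0n.
  apply: le_trans (f1.2 _) _; rewrite mul1r.
  have [Ou Tuv uE] := uvP n; have Ov := TO _ Ou _ Tuv.
  (* The damped equation makes the defect a multiple of [x0 - v n], whose norm is at most 2M. *)
  have -> : u n - v n = n.+2%:R^-1 *: (x0 - v n).
    by rewrite {1}uE subKr scalerBl scale1r addrAC (addrAC (v n)) subrr add0r addrC scalerBr.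
  rewrite normrZ ger0_norm ?invr_ge0 ?ler0n// mulrC ler_pM// ?invr_ge0 ?ler0n//.
    by apply: le_trans (ler_normB _ _) _; rewrite lerD// OM.
  by rewrite lef_pV2 ?posrE ?ltr0n// ler_nat.
have [phi iphi [x ux]] := T_hemi u v (fun n => let: And3 Ou _ _ := uvP n in Ou)
  (fun n => let: And3 _ Tuv _ := uvP n in Tuv) (ex_intro _ 0 uv0).
have Ox : Omega x.
  apply: (weak_cvg_closed_convex Omega (fmap (u \o phi) \oo)) => //.
    by exists 0%N => // n _; have [] := uvP (phi n).
  by move=> f f1; exact: (weak_cvg_seqP _ _).1 ux f f1.
exists x; split=> //; apply: (T_graph (u \o phi) (v \o phi)) => //.
- by move=> n; apply: OS; have [] := uvP (phi n).
- exact: OS.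
- by move=> n; have [] := uvP (phi n).
apply/weak_cvg_seqP => f f1.
have fu := (weak_cvg_seqP _ _).1 ux f f1.
have fuv := (weak_cvg_seqP _ _).1 (weak_cvg_increasing phi _ _ iphi uv0) f f1.
(* Since v = u - (u - v) and the difference is weakly null, [v] has the same weak limit as [u] along
   [phi]. *)
have hl : f (u (phi n)) - f (u (phi n) - v (phi n)) @[n --> \oo] --> f x - f 0.
  exact: cvgB fu fuv.
have fvE : (fun n => f (u (phi n)) - f (u (phi n) - v (phi n))) = f \o v \o phi.
  by apply/funext => n; rewrite /= (dual_ballB _ _ _ _ f1) subKr.
by rewrite fvE (dual_ball0 _ _ f1) subr0 in hl.
Qed.
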